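(* Let $R$ be a semiprime left Goldie ring and let $A=\sigma(R)\langle x_1,\dots,x_n\rangle$ be a bijective skew PBW extension of $R$. Then $A$ is semiprime left Goldie; hence $Q_l(A)$ exists and is semisimple. The right-side version also holds: if $R$ is semiprime right Goldie, then $A$ is semiprime right Goldie, and hence $Q_r(A)$ exists and is semisimple.
   Context: Rings are associative with identity. Skew PBW extension. Let $R$ and $A$ be rings. $A$ is a skew PBW extension of $R$, written $A=\sigma(R)\langle x_1,\dots,x_n\rangle$, if the following hold. (i) $R\subseteq A$. (ii) There are $x_1,\dots,x_n\in A$ such that $A$ is a free left $R$-module with basis $\{x_1^{\alpha_1}\cdots x_n^{\alpha_n}:\alpha\in\mathbb N^n\}$. (iii) For each $i$ and $r\in R\setminus\{0\}$ there is $c_{i,r}\in R\setminus\{0\}$ with $x_ir-c_{i,r}x_i\in R$. (iv) For all $i,j$ there is $c_{i,j}\in R\setminus\{0\}$ with $x_jx_i-c_{i,j}x_ix_j\in R+Rx_1+\dots+Rx_n$. There are injective endomorphisms $\sigma_i$ of $R$ and $\sigma_i$-derivations $\delta_i$ with $x_ir=\sigma_i(r)x_i+\delta_i(r)$. $A$ is bijective if every $\sigma_i$ is bijective and every $c_{i,j}$ ($i<j$) is invertible. $Q_l(A)$ (respectively $Q_r(A)$) is the left (respectively right) total ring of fractions, i.e. the classical left (right) ring of fractions with respect to all regular elements. *)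

(* Defs.v *)
From HB Require Import structures.
From mathcomp Require Import all_boot all_order all_algebra.
Set Implicit Arguments. Unset Strict Implicit. Unset Printing Implicit Defensive.
Import GRing.Theory.
Local Open Scope ring_scope.

Section RingNotions.
Variable T : pzRingType.

Definition left_ideal (L : T -> Prop) : Prop :=
  [/\ L 0, (forall a b, L a -> L b -> L (a + b)) & (forall r a, L a -> L (r * a))].
Definition right_ideal (L : T -> Prop) : Prop :=
  [/\ L 0, (forall a b, L a -> L b -> L (a + b)) & (forall r a, L a -> L (a * r))].
Definition two_sided_ideal (I : T -> Prop) : Prop :=
  left_ideal I /\ (forall r a, I a -> I (a * r)).

Definition nilpotent_ideal (I : T -> Prop) : Prop :=
  exists m : nat, forall a : 'I_m -> T, (forall k, I (a k)) -> \prod_(k < m) a k = 0.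

Definition semiprime : Prop :=
  forall I, two_sided_ideal I -> nilpotent_ideal I -> forall a, I a -> a = 0.

Definition lann (X : T -> Prop) : T -> Prop := fun r => forall y, X y -> r * y = 0.
Definition rann (X : T -> Prop) : T -> Prop := fun r => forall y, X y -> y * r = 0.

Definition ACC_lann : Prop :=
  forall X : nat -> T -> Prop,
    (forall k r, lann (X k) r -> lann (X k.+1) r) ->
    exists N, forall k, (N <= k)%N -> forall r, lann (X k) r <-> lann (X N) r.
Definition ACC_rann : Prop :=
  forall X : nat -> T -> Prop,
    (forall k r, rann (X k) r -> rann (X k.+1) r) ->
    exists N, forall k, (N <= k)%N -> forall r, rann (X k) r <-> rann (X N) r.

Definition independent_family (L : nat -> T -> Prop) : Prop :=
  forall (m : nat) (a : nat -> T), (forall k, (k < m)%N -> L k (a k)) ->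
    \sum_(k < m) a k = 0 -> forall k, (k < m)%N -> a k = 0.

Definition finite_left_udim : Prop :=
  ~ exists L : nat -> T -> Prop,
      [/\ forall k, left_ideal (L k), forall k, exists2 a, L k a & a != 0
        & independent_family L].
Definition finite_right_udim : Prop :=
  ~ exists L : nat -> T -> Prop,
      [/\ forall k, right_ideal (L k), forall k, exists2 a, L k a & a != 0
        & independent_family L].

Definition left_goldie : Prop := ACC_lann /\ finite_left_udim.
Definition right_goldie : Prop := ACC_rann /\ finite_right_udim.

Definition regular (s : T) : Prop :=
  (forall b, s * b = 0 -> b = 0) /\ (forall b, b * s = 0 -> b = 0).

Definition invertible (u : T) : Prop := exists v, v * u = 1 /\ u * v = 1.

Definition semisimple_ring : Prop :=
  forall L, left_ideal L -> exists L', left_ideal L' /\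
    (forall a, L a -> L' a -> a = 0) /\ (forall q, exists a b, L a /\ L' b /\ q = a + b).

End RingNotions.

Definition is_left_quotient_ring (T Q : pzRingType) (phi : {rmorphism T -> Q}) : Prop :=
  [/\ injective phi,
      forall s, regular s -> invertible (phi s)
    & forall q : Q, exists s a, regular s /\ phi s * q = phi a].
Definition is_right_quotient_ring (T Q : pzRingType) (phi : {rmorphism T -> Q}) : Prop :=
  [/\ injective phi,
      forall s, regular s -> invertible (phi s)
    & forall q : Q, exists s a, regular s /\ q * phi s = phi a].

Definition Ql_exists_semisimple (T : pzRingType) : Prop :=
  exists (Q : pzRingType) (phi : {rmorphism T -> Q}),
    is_left_quotient_ring phi /\ semisimple_ring Q.
Definition Qr_exists_semisimple (T : pzRingType) : Prop :=
  exists (Q : pzRingType) (phi : {rmorphism T -> Q}),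
    is_right_quotient_ring phi /\ semisimple_ring Q.

Section SkewPBW.
Variables (R A : pzRingType) (emb : {rmorphism R -> A}) (n : nat) (x : 'I_n -> A).

Definition monom (alpha : n.-tuple nat) : A := \prod_(i < n) x i ^+ tnth alpha i.

Definition skew_PBW : Prop :=
  [/\ injective emb,
      (forall a : A, exists (s : seq (n.-tuple nat)) (c : n.-tuple nat -> R),
          a = \sum_(al <- s) emb (c al) * monom al),
      (forall (s : seq (n.-tuple nat)) (c : n.-tuple nat -> R), uniq s ->
          \sum_(al <- s) emb (c al) * monom al = 0 -> forall al, al \in s -> c al = 0),
      (forall i (r : R), r != 0 -> exists c : R, c != 0 /\
          exists d : R, x i * emb r - emb c * x i = emb d)
    &
      (forall i j, exists c : R, c != 0 /\
          exists (d0 : R) (d : 'I_n -> R),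
            x j * x i - emb c * (x i * x j) = emb d0 + \sum_(k < n) emb (d k) * x k)].

(* sigma_i(r) = s, i.e. x_i r = s x_i + delta_i(r) with delta_i(r) in R *)
Definition sigma_rel (i : 'I_n) (r s : R) : Prop :=
  exists d : R, x i * emb r = emb s * x i + emb d.

Definition bijective_skew_PBW : Prop :=
  (forall i, (forall s, exists r, sigma_rel i r s) /\
             (forall r r' s, sigma_rel i r s -> sigma_rel i r' s -> r = r')) /\
  (forall i j : 'I_n, (i < j)%N -> forall c : R,
     (exists (d0 : R) (d : 'I_n -> R),
        x j * x i - emb c * (x i * x j) = emb d0 + \sum_(k < n) emb (d k) * x k) ->
     invertible c).

End SkewPBW.

(* Main.v *)
(* Everything in sight is filtered by leading terms. In a bijective skew PBW
   extension the monomials, ordered degree-lexicographically, multiply up to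
   units and lower terms, and commute with coefficients up to automorphisms
   [sig g] and lower terms ([pbw] below); this structure is left-right
   symmetric, so the right-hand half follows by passing to opposite rings.

   Semiprimeness, nonsingularity and finite uniform dimension pass from [R] to
   [A] by looking at leading coefficients; for the uniform dimension one compares
   the numbers of monomials of bounded degree, as with a Hilbert function. A
   nonsingular ring of finite uniform dimension satisfies the ascending chain
   condition on annihilators, so [A] is left Goldie without any localization.

   For Goldie's theorem, the quotient ring is realised as the maximal left
   quotient ring: homomorphisms to the ring from essential left ideals, two of
   them being identified when they agree on an essential left ideal. *)
From HB Require Import structures.
Require Import Defs.
From mathcomp Require Import all_boot all_order all_algebra.
From mathcomp Require Import boolp mpoly.
Set Implicit Arguments. Unset Strict Implicit. Unset Printing Implicit Defensive.
Import Order.TTheory GRing.Theory.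
Local Open Scope ring_scope.

(** * Choice, semiprimeness and uniform dimension *)

(** The relation for [x j * x i] may involve every variable, so the variables are not adjoined one
    at a time; all monomials are handled at once. The main obstacle is that the leading coefficient
    [l] of an element of [A] can be a zero divisor, so that leading terms may disappear under
    multiplication. Nonsingularity of [R] is the remedy: for [l <> 0] there is a nonzero [s] such
    that right multiplication by [l] is injective on [R s], and working with multiples of [s] keeps
    the leading terms alive. The annihilator chain condition is never transferred from [R] to [A];
    it is recovered in [A] from nonsingularity and uniform dimension. Counting monomials requires a
    number, whereas [finite_left_udim] only forbids infinite independent families; uniform elements
    supply the numerical bound. The count works because the ratio between the monomials available
    and the monomials used is bounded by [n.+1 ^ n], whatever the degrees of the elements. Since
    [semisimple_ring] speaks of left ideals, the right-hand half also needs the left-right symmetry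
    of semisimplicity. *)

Section Choice.

Lemma chain_choice (T : Type) (P : T -> Prop) (S : T -> T -> Prop) (x0 : T) :
  P x0 -> (forall x, P x -> exists y, P y /\ S x y) ->
  exists f : nat -> T, forall k, P (f k) /\ S (f k) (f k.+1).
Proof.
move=> Px0 Hstep.
have /choice[g Hg] : forall x, exists y, P x -> P y /\ S x y.
  move=> x; have [Px|nPx] := pselect (P x); last by exists x.
  by have [y Hy] := Hstep x Px; exists y.
have HP k : P (iter k g x0) by elim: k => //= k /Hg[].
by exists (fun k => iter k g x0) => k; split=> //; case: (Hg _ (HP k)).
Qed.

Fixpoint prefix_rev (T : Type) (f : nat -> T) (n : nat) : seq T :=
  if n is m.+1 then f m :: prefix_rev f m else [::].

(** Unlike in [chain_choice], each choice may depend on all earlier ones. The newest element stands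
    at the head, the order in which [adjoin] and [indep] read lists. *)
Lemma list_choice (T : Type) (x0 : T) (P : seq T -> Prop) :
  P [::] -> (forall s, P s -> exists x, P (x :: s)) ->
  exists f : nat -> T, forall n, P (prefix_rev f n).
Proof.
move=> P0 Hstep.
have /choice[g Hg] : forall s, exists x, P s -> P (x :: s).
  move=> s; have [Ps|nPs] := pselect (P s); last by exists x0.
  by have [x Hx] := Hstep s Ps; exists x.
pose h n := iter n (fun s => g s :: s) [::].
have hE n : prefix_rev (fun k => g (h k)) n = h n by elim: n => //= n ->.
exists (fun k => g (h k)) => n; rewrite hE.
by elim: n => //= n; apply: Hg.
Qed.

End Choice.

(** * Elementwise form of semiprimeness *)

Section Semiprime.
Variable T : pzRingType.

Definition elt_semiprime : Prop :=
  forall a : T, (forall r, a * r * a = 0) -> a = 0.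

(** No ideal generated by [a] is formed. With [W] the two-sided ideal of all [x] such that
    [x T a = 0], the ideal [I] of those [x] in [W] with [W x = 0] has square zero and contains
    [a]. *)
Lemma semiprime_elt : semiprime T -> elt_semiprime.
Proof.
move=> sT a Ha.
pose W x := forall t : T, x * t * a = 0.
pose I x := W x /\ forall w, W w -> w * x = 0.
have WM r w : W w -> W (w * r).
  by move=> Ww t; rewrite -(mulrA w); apply: Ww.
apply: (sT I).
- split; first split.
  + by split=> [t|w _]; rewrite ?mul0r ?mulr0.
  + move=> x y [Wx Ix] [Wy Iy]; split=> [t|w Ww].
      by rewrite !mulrDl Wx Wy addr0.
    by rewrite mulrDr Ix // Iy // addr0.
  + move=> r x [Wx Ix]; split=> [t|w Ww].
      by rewrite -2!mulrA (mulrA x) Wx mulr0.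
    by rewrite mulrA Ix //; apply: WM.
  + move=> r x [Wx Ix]; split; first exact: WM.
    by move=> w Ww; rewrite mulrA Ix // mul0r.
- exists 2 => b Hb; rewrite !big_ord_recl big_ord0 mulr1.
  by case: (Hb ord0) => W0 _; case: (Hb (lift ord0 ord0)) => _; apply.
- by split=> // w Ww; have := Ww 1; rewrite mulr1.
Qed.

(** If all products of [m.+2] elements of [I] vanish and [p] is a product of [m.+1] of them, then
    [p * r * p] starts with [p] times [r * a 0], a product of [m.+2] elements. Hence [p = 0], and
    the exponent drops to one. *)
Lemma elt_semiprimeP : elt_semiprime -> semiprime T.
Proof.
move=> sT I [[I0 ID IMl] IMr] [m Hm].
have {Hm} : forall a : nat -> T, (forall k, I (a k)) -> \prod_(k < m) a k = 0.
  by move=> a Ia; apply: Hm.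
elim: m => [|m IHm] Hm.
  have := Hm (fun=> 0) (fun=> I0); rewrite big_ord0 => T0 a _.
  by rewrite -[a]mul1r T0 mul0r.
case: m => [|m] in IHm Hm *.
  by move=> a Ia; have := Hm (fun=> a) (fun=> Ia); rewrite big_ord_recl big_ord0 mulr1.
apply: IHm => a Ia; apply: sT => r.
rewrite [X in _ * X]big_ord_recl !mulrA -(mulrA _ r).
have := Hm (fun k => if (k < m.+1)%N then a k else r * a 0).
rewrite big_ord_recr /= ltnn.
under eq_bigr do rewrite ltn_ord.
move=> -> ; first by rewrite mul0r.
by move=> k; case: ifP => _ //; apply: IMl.
Qed.

End Semiprime.

Lemma elt_semiprime_conv (T : pzRingType) : elt_semiprime T -> elt_semiprime T^c.
Proof. by move=> sT a Ha; apply: sT => r; rewrite -mulrA; apply: Ha. Qed.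

(** * Uniform dimension, counted by independent elements *)

Section Modules.
Variables (R A : pzRingType) (emb : {rmorphism R -> A}).

Definition submod (P : A -> Prop) : Prop :=
  [/\ P 0, forall a b, P a -> P b -> P (a + b) & forall r a, P a -> P (emb r * a)].

Lemma submodN P a : submod P -> P a -> P (- a).
Proof. by case=> _ _ PM Pa; rewrite -mulN1r -(rmorph1 emb) -rmorphN; apply: PM. Qed.

Lemma submodB P a b : submod P -> P a -> P b -> P (a - b).
Proof. by move=> sP Pa Pb; case: (sP) => _ PD _; apply: PD => //; apply: submodN. Qed.

Lemma submod_sum P (I : Type) (s : seq I) (Q : pred I) (F : I -> A) :
  submod P -> (forall i, Q i -> P (F i)) -> P (\sum_(i <- s | Q i) F i).
Proof. by case=> P0 PD _ HF; apply: big_ind. Qed.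

(* The uniform dimension of [P] is at most [p]: independence of the cyclic
   submodules spanned by the [v i] replaces direct sums of submodules. *)
Definition udim_le (P : A -> Prop) (p : nat) : Prop :=
  forall (I : finType) (J : {set I}) (v : I -> A),
    (forall i, i \in J -> P (v i) /\ v i <> 0) ->
    (forall c : I -> R, \sum_(i in J) emb (c i) * v i = 0 ->
       forall i, i \in J -> emb (c i) * v i = 0) ->
    (#|J| <= p)%N.

(** Choose [K] maximal in [J] such that a combination over [K] lying in [P'] vanishes. The
    [Q]-components of the [v i] with [i] in [K] are then independent, so [K] has at most [q]
    elements. For [i] outside [K], maximality gives a nonzero combination [z i] over [i |: K] lying
    in [P']; these are independent too, so at most [p] indices remain. *)
Lemma udim_le_add P P' Q p q :
  submod P' -> submod Q -> (forall x, P' x -> Q x -> x = 0) ->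
  (forall x, P x -> exists2 y, Q y & P' (x - y)) ->
  udim_le P' p -> udim_le Q q -> udim_le P (p + q).
Proof.
move=> sP' sQ PQ0 PQ dP' dQ I J v Hv Hind.
have [P'0 _ P'M] := sP'; have [_ _ QM] := sQ.
pose good (K : {set I}) := K \subset J /\
  forall c : I -> R, P' (\sum_(i in K) emb (c i) * v i) ->
    \sum_(i in K) emb (c i) * v i = 0.
have good0 : `[<good set0>].
  by apply/asboolP; split; [exact: sub0set | move=> c _; rewrite big_set0].
have [K /maxsetP[/asboolP[KJ gK] Kmax] _] := maxset_exists (P := fun K => `[<good K>]) good0.
have sumK (K' : {set I}) (c : I -> R) : K' \subset J -> 
    \sum_(i in K') emb (c i) * v i
    = \sum_(i in J) emb (if i \in K' then c i else 0) * v i.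
  move=> /subsetP K'J; rewrite big_mkcond [RHS]big_mkcond; apply: eq_bigr => i _.
  have [/K'J->//|_] := boolP (i \in K').
  by rewrite rmorph0 mul0r if_same.
have cardK : (#|K| <= q)%N.
  have /choice[w Hw] : forall i, exists y, i \in J -> Q y /\ P' (v i - y).
    move=> i; have [iJ|] := boolP (i \in J); last by exists 0.
    by have [y ? ?] := PQ _ (Hv i iJ).1; exists y.
  apply: (dQ I K w) => [i iK|c c0 i iK].
    have iJ := subsetP KJ i iK; have [Qw P'vw] := Hw i iJ; split=> // w0.
    case: (Hv i iJ) => _; apply.
    have sum1 : \sum_(j in K) emb (if j == i then 1 else 0) * v j = v i.
      rewrite (bigD1 i) //= eqxx rmorph1 mul1r big1 ?addr0 // => j /andP[_ /negPf->].
      by rewrite rmorph0 mul0r.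
    by rewrite -sum1 gK // sum1 -[v i]subr0 -w0.
  have iJ := subsetP KJ i iK; have [Qw P'vw] := Hw i iJ.
  apply: PQ0; last exact: QM.
  have cv0 : \sum_(j in K) emb (c j) * v j = 0.
    apply: gK; have -> : \sum_(j in K) emb (c j) * v j
        = \sum_(j in K) (emb (c j) * v j - emb (c j) * w j).
      by rewrite sumrB c0 subr0.
    apply: submod_sum => // j jK; rewrite -mulrBr; apply: P'M.
    by case: (Hw j (subsetP KJ j jK)).
  have cvi : emb (c i) * v i = 0.
    by have := cv0; rewrite sumK // => /Hind/(_ i iJ); rewrite iK.
  have -> : emb (c i) * w i = - (emb (c i) * (v i - w i)).
    by rewrite mulrBr cvi sub0r opprK.
  by apply: submodN => //; apply: P'M.
have cardJK : (#|J :\: K| <= p)%N.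
  have /choice[c Hc] : forall i, exists c : I -> R, i \in J :\: K ->
      P' (\sum_(j in i |: K) emb (c j) * v j) /\ \sum_(j in i |: K) emb (c j) * v j <> 0.
    move=> i; have [|] := boolP (i \in J :\: K); last by exists (fun=> 0).
    rewrite inE => /andP[iK iJ]; apply: contrapT => Hno.
    have : i |: K = K.
      apply: Kmax; last exact: subsetUr.
      apply/asboolP; split; first by rewrite subUset sub1set iJ.
      move=> c Pc; apply: contrapT => c0; apply: Hno; exists c => _; split=> //.
    by move/setP/(_ i); rewrite !inE eqxx (negPf iK).
  pose z i := \sum_(j in i |: K) emb (c i j) * v j.
  have zE i : i \in J :\: K -> z i = emb (c i i) * v i + \sum_(j in K) emb (c i j) * v j.
    by rewrite inE => /andP[iK _]; rewrite /z big_setU1.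
  apply: (dP' I _ z) => [i /Hc//|d d0 i iJK].
  have dzi : emb (d i * c i i) * v i = 0.
    pose e j := if j \in K then \sum_(k in J :\: K) d k * c k j else d j * c j j.
    have : \sum_(j in J) emb (e j) * v j = 0.
      rewrite (big_setID K) /= (setIidPr KJ) -[RHS]d0 (eq_bigr _ (fun k kJK => congr1 _ (zE k kJK))).
      under [RHS]eq_bigr do rewrite mulrDr.
      rewrite big_split addrC /=; congr (_ + _).
        apply: eq_bigr => j; rewrite inE => /andP[/negPf jK _].
        by rewrite /e jK rmorphM mulrA.
      under [RHS]eq_bigr do rewrite mulr_sumr.
      rewrite exchange_big /=; apply: eq_bigr => j jK.
      rewrite /e jK rmorph_sum mulr_suml; apply: eq_bigr => k _.
      by rewrite rmorphM mulrA.
    move: iJK; rewrite inE => /andP[/negPf iK iJ] /Hind/(_ i iJ).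
    by rewrite /e iK.
  have := zE i iJK => /(congr1 ( *%R (emb (d i)))).
  rewrite mulrDr mulrA -rmorphM dzi add0r mulr_sumr => dz.
  rewrite dz; under eq_bigr do rewrite mulrA -rmorphM.
  apply: gK; under eq_bigr do rewrite rmorphM -mulrA.
  by rewrite -mulr_sumr mulr_sumr -dz; apply: P'M; case: (Hc i iJK).
by rewrite -(cardsID K J) addnC leq_add // (setIidPr KJ).
Qed.

Lemma udim_le_sub P P' p : (forall x, P x -> P' x) -> udim_le P' p -> udim_le P p.
Proof. by move=> PP' dP' I J v Hv; apply: dP' => i /Hv[/PP']. Qed.

Lemma udim_le0 : udim_le (fun x => x = 0) 0.
Proof.
move=> I J v Hv _; rewrite leqn0 cards_eq0; apply/eqP/setP => i; rewrite inE.
by apply/negbTE/negP => /Hv[].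
Qed.

Lemma udim_le_ess P p :
  submod P -> (forall x, x <> 0 -> exists r, P (emb r * x) /\ emb r * x <> 0) ->
  udim_le P p -> udim_le (fun=> True) p.
Proof.
move=> sP eP dP I J v Hv Hind.
have /choice[r Hr] : forall i, exists r, i \in J -> P (emb r * v i) /\ emb r * v i <> 0.
  move=> i; have [iJ|] := boolP (i \in J); last by exists 0.
  by have [r Hr] := eP _ (Hv i iJ).2; exists r.
apply: (dP I J (fun i => emb (r i) * v i)) => [i /Hr//|c c0 i iJ].
rewrite mulrA -rmorphM; apply: (Hind (fun i => c i * r i)) => //.
by rewrite -[RHS]c0; apply: eq_bigr => j _; rewrite rmorphM mulrA.
Qed.

End Modules.

(** * Left Goldie rings *)

Section LeftGoldie.
Variable T : pzRingType.

(** For a left ideal this is essentiality. [E] is an arbitrary predicate, so that annihilators and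
    domains of graphs can be used without bundling an ideal. *)
Definition ess (E : T -> Prop) : Prop :=
  forall a, a <> 0 -> exists t, E (t * a) /\ t * a <> 0.

Definition nonsingular : Prop :=
  forall a, ess (fun t => t * a = 0) -> a = 0.

Lemma ess_sub (E E' : T -> Prop) : (forall t, E t -> E' t) -> ess E -> ess E'.
Proof. by move=> EE' eE a /eE[t [/EE' ? ?]]; exists t. Qed.

Lemma ess_preim (E : T -> Prop) b : E 0 -> ess E -> ess (fun t => E (t * b)).
Proof.
move=> E0 eE a a0; have [ab0|/eqP/eE[t [Et /eqP tab0]]] := eqVneq (a * b) 0.
  by exists 1; rewrite mul1r ab0.
exists t; rewrite -mulrA; split=> //; apply/eqP; apply: contra_neq tab0.
by rewrite mulrA => ->; rewrite mul0r.
Qed.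

Lemma ess_cap (E E' : T -> Prop) : ess E -> (forall r a, E' a -> E' (r * a)) -> ess E' ->
  ess (fun t => E t /\ E' t).
Proof.
move=> eE E'M eE' a /eE'[t' [E't' /eE[t [Et ?]]]].
by exists (t * t'); rewrite -mulrA; split=> //; split=> //; apply: E'M.
Qed.

Lemma nonsingular_ess (E : T -> Prop) a :
  nonsingular -> ess E -> (forall t, E t -> t * a = 0) -> a = 0.
Proof. by move=> nT eE Ea; apply: nT; apply: ess_sub eE. Qed.

(** This is the left ideal [I + T v1 + ... + T vk], for a left ideal [I]. *)
Fixpoint adjoin (I : T -> Prop) (s : seq T) (x : T) : Prop :=
  if s is v :: s' then exists r, adjoin I s' (x - r * v) else I x.

Fixpoint indep (I : T -> Prop) (s : seq T) : Prop :=
  if s is v :: s' then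
    [/\ v <> 0, forall r, adjoin I s' (r * v) -> r * v = 0 & indep I s']
  else True.

Definition zero_ideal (x : T) : Prop := x = 0.

Lemma left_ideal0 : left_ideal zero_ideal.
Proof. by split=> // [a b ->->|r a ->]; rewrite /zero_ideal ?addr0 ?mulr0. Qed.

Lemma left_idealN (I : T -> Prop) a : left_ideal I -> I a -> I (- a).
Proof. by move=> lI; apply: (submodN (emb := idfun) lI). Qed.

Lemma left_idealB (I : T -> Prop) a b : left_ideal I -> I a -> I b -> I (a - b).
Proof. by move=> lI; apply: (submodB (emb := idfun) lI). Qed.

Lemma adjoin_ideal I s : left_ideal I -> left_ideal (adjoin I s).
Proof.
move=> lI; elim: s => //= v s [s0 sD sM]; split.
- by exists 0; rewrite mul0r subr0.
- by move=> a b [r Ha] [r' Hb]; exists (r + r'); rewrite mulrDl opprD addrACA; apply: sD.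
- by move=> t a [r Ha]; exists (t * r); rewrite -mulrA -mulrBr; apply: sM.
Qed.

Lemma adjoin_base I s x : left_ideal I -> I x -> adjoin I s x.
Proof.
by move=> lI Ix; elim: s => //= v s IHs; exists 0; rewrite mul0r subr0.
Qed.

Lemma adjoin_sub (I L : T -> Prop) s : left_ideal L -> (forall x, I x -> L x) ->
  (forall v, v \in s -> L v) -> forall x, adjoin I s x -> L x.
Proof.
move=> [_ LD LM] IL; elim: s => [_|v s IHs sL x /= [r Hr]]; first exact: IL.
rewrite -[x](subrK (r * v)); apply: LD.
  by apply: IHs => // w ws; apply: sL; rewrite inE ws orbT.
by apply: LM; apply: sL; rewrite mem_head.
Qed.

(** The common engine of the finiteness arguments below: a list is extended while [P] and
    independence over [I] persist. If this never stopped, the cyclic left ideals of the chosen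
    elements would form an infinite independent family. When it stops, every nonzero [x] still
    allowed by [P] has a nonzero multiple in [adjoin I s]. *)
Lemma udim_chain I (P : seq T -> Prop) :
  finite_left_udim T -> left_ideal I -> P [::] ->
  exists s, [/\ P s, indep I s &
    forall x, P (x :: s) -> x <> 0 -> exists r, adjoin I s (r * x) /\ r * x <> 0].
Proof.
move=> fT lI P0; apply: contrapT => Hno; apply: fT.
have [s [Ps Is]|f Hf] := @list_choice T 0 (fun s => P s /\ indep I s) (conj P0 Logic.I).
  apply: contrapT => Hs; apply: Hno; exists s; split=> // x Pxs x0.
  apply: contrapT => Hr; apply: Hs; exists x; split=> //=; split=> // r Hadj.
  by apply: contrapT => rx0; apply: Hr; exists r.
have f0 n : f n <> 0 by have [_ []] := Hf n.+1.
have fI n r : adjoin I (prefix_rev f n) (r * f n) -> r * f n = 0.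
  by have [_ [_]] := Hf n.+1 => + _; apply.
exists (fun k x => exists r, x = r * f k); split.
- move=> k; split; first by exists 0; rewrite mul0r.
    by move=> _ _ [r ->] [r' ->]; exists (r + r'); rewrite mulrDl.
  by move=> t _ [r ->]; exists (t * r); rewrite mulrA.
- by move=> k; exists (f k); [exists 1; rewrite mul1r | apply/eqP].
elim=> [|m IHm] a Ha; first by [].
have adjS : forall j, (j <= m)%N -> adjoin I (prefix_rev f j) (\sum_(k < j) a k).
  elim=> [|j IHj] jm; first by rewrite big_ord0; case: lI.
  have [r ar] := Ha j (leqW jm); exists r => /=.
  by rewrite big_ord_recr /= ar addrK; apply: IHj; apply: ltnW.
rewrite big_ord_recr /= => S0.
have am0 : a m = 0.
  have [r ar] := Ha m (ltnSn m); rewrite ar; apply: fI.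
  rewrite -ar; have -> : a m = - \sum_(k < m) a k.
    by apply/eqP; rewrite -addr_eq0 addrC S0.
  by apply: left_idealN (adjS m (leqnn m)); apply: adjoin_ideal.
move=> k; rewrite ltnS leq_eqVlt => /orP[/eqP->//|km].
apply: IHm => // [j jm|]; first by apply: Ha; apply: ltnW.
by rewrite am0 addr0 in S0.
Qed.

Definition uniform (b : T) : Prop := b <> 0 /\
  forall r s, r * b <> 0 -> s * b <> 0 ->
    exists p q, p * (r * b) = q * (s * b) /\ p * (r * b) <> 0.

(** The list [s] grows while some nonzero multiple [b] of [a] stays independent of it. At a maximal
    [s] this [b] is uniform: of two nonzero multiples of [b] without common nonzero multiple, one
    could extend [s] and the other replace [b]. *)
Lemma uniform_multiple a :
  finite_left_udim T -> a <> 0 -> exists t, uniform (t * a).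
Proof.
move=> fT a0.
have [] := @udim_chain zero_ideal (fun s => exists b, [/\ exists t, b = t * a, b <> 0
  & forall r, adjoin zero_ideal s (r * b) -> r * b = 0]) fT left_ideal0.
  by exists a; split=> //; exists 1; rewrite mul1r.
move=> s [[b [[t bE] b0 bs]] _ Hmax].
exists t; rewrite -bE; split=> // r q rb0 qb0; apply: contrapT => Hno.
have [|//|p [/= padj prb0]] := Hmax (r * b); last first.
  by apply: prb0; rewrite mulrA; apply: bs; rewrite -mulrA.
exists (q * b); split=> //; first by exists (q * t); rewrite bE mulrA.
move=> p /= [p']; rewrite !mulrA -mulrBl => /bs/eqP.
rewrite mulrBl subr_eq0 => /eqP pqE; apply: contrapT => pqb0.
by apply: Hno; exists p', p; rewrite !mulrA -pqE.
Qed.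

Lemma uniform_udim b : uniform b -> udim_le idfun (fun x => exists r, x = r * b) 1.
Proof.
move=> [_ Ub] I J v Hv Hind; rewrite leqNgt; apply/negP => /card_gt1P[i [j [iJ jJ ij]]].
have [[r vi] vi0] := Hv i iJ; have [[q vj] vj0] := Hv j jJ.
rewrite vi in vi0; rewrite vj in vj0; have [p [p' [pE]]] := Ub r q vi0 vj0; apply.
have := Hind (fun k => if k == i then p else if k == j then - p' else 0) _ i iJ.
rewrite eqxx vi; apply => /=.
rewrite (bigD1 i) // (bigD1 j) /=; last by rewrite jJ eq_sym.
rewrite eqxx eq_sym (negPf ij) eqxx big1 => [|k /andP[/andP[_ /negPf->] /negPf->]].
  by rewrite addr0 vi vj pE mulNr subrr.
by rewrite mul0r.
Qed.

(** A maximal independent list of uniform elements spans an essential left ideal, since every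
    nonzero element has a uniform multiple. Each member contributes at most one to the dimension. *)
Lemma udim_bound : finite_left_udim T -> exists u, udim_le (@idfun T) (fun=> True) u.
Proof.
move=> fT.
have [|s [sU sI smax]] := @udim_chain zero_ideal (fun s => forall v, v \in s -> uniform v)
  fT left_ideal0; first by [].
exists (size s); apply: (@udim_le_ess _ _ _ (adjoin zero_ideal s)).
- exact: adjoin_ideal left_ideal0.
- move=> x x0; have [t Ut] := uniform_multiple fT x0.
  have [|tx0|r Hr] := smax (t * x); last by exists (r * t); rewrite /= -mulrA.
    by move=> v; rewrite inE => /orP[/eqP->//|/sU].
  by case: Ut => /(_ tx0).
elim: s sU sI {smax} => [_ _|v s IHs sU /= [v0 vs sI]]; first exact: udim_le0.
rewrite -addn1; apply: (@udim_le_add _ _ _ _ (adjoin zero_ideal s) (fun x => exists r, x = r * v)).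
- exact: adjoin_ideal left_ideal0.
- split=> [|_ _ [r ->] [r' ->]|t _ [r ->]]; first by exists 0; rewrite mul0r.
    by exists (r + r'); rewrite mulrDl.
  by exists (t * r); rewrite mulrA.
- by move=> _ /[swap] -[r ->]; apply: vs.
- by move=> x [r Hr]; exists (r * v) => //; exists r.
- by apply: IHs => // w ws; apply: sU; rewrite inE ws orbT.
- by apply: uniform_udim; apply: sU; rewrite mem_head.
Qed.

(** Take a maximal independent list inside the union of the chain; it lies in some [lann (X N)]. If
    [c] enters later, then [c * y <> 0] for some [y] in [X N], and nonsingularity gives [a <> 0]
    such that right multiplication by [c * y] is injective on [T a]. By maximality [a * c] has a
    nonzero multiple in [lann (X N)], which kills [y]: a contradiction. *)
Lemma nonsingular_ACC_lann : nonsingular -> finite_left_udim T -> ACC_lann T.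
Proof.
move=> nT fT X Xmono.
have {}Xmono j k : (j <= k)%N -> forall r, lann (X j) r -> lann (X k) r.
  move=> /subnK <-; elim: (k - j)%N => // i IHi r Hr.
  by rewrite addSn; apply: Xmono; apply: IHi.
have lX k : left_ideal (lann (X k)).
  split=> [y _|a b Ha Hb y Xy|r a Ha y Xy]; first by rewrite mul0r.
    by rewrite mulrDl Ha ?Hb ?addr0.
  by rewrite -mulrA Ha ?mulr0.
have [|s [[N sN] _ smax]] := @udim_chain zero_ideal
  (fun s => exists N, forall v, v \in s -> lann (X N) v) fT left_ideal0; first by exists 0%N.
exists N => k Nk c; split=> [ck y Xy|]; last exact: Xmono.
apply: contrapT => cy0.
have [a [a0 ann_a]] : exists a, a <> 0 /\ forall t, t * a * (c * y) = 0 -> t * a = 0.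
  apply: contrapT => Ha; apply: cy0; apply: nT => a a0.
  apply: contrapT => Ht; apply: Ha; exists a; split=> // t tacy.
  by apply: contrapT => ta0; apply: Ht; exists t.
have [||r [Hadj rac0]] := smax (a * c).
- exists k => v; rewrite inE => /orP[/eqP->|/sN]; last exact: Xmono.
  by have [_ _] := lX k; apply.
- by move=> ac0; apply: a0; rewrite -[a]mul1r; apply: ann_a; rewrite mul1r mulrA ac0 mul0r.
apply: rac0; rewrite mulrA ann_a ?mul0r //.
have : lann (X N) (r * (a * c)) by apply: adjoin_sub sN _ Hadj => // _ ->; case: (lX N).
by move=> /(_ y Xy); rewrite !mulrA.
Qed.

(** If [T a] met [T s] only in zero, the left ideals [T (a * s ^+ k)] would form an infinite
    independent family. *)
Lemma cancel_ess s : finite_left_udim T -> (forall b, b * s = 0 -> b = 0) ->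
  ess (fun x => exists r, x = r * s).
Proof.
move=> fT Hs a a0; apply: contrapT => Hno; apply: fT.
have sX k b : b * s ^+ k = 0 -> b = 0.
  by elim: k b => [|k IHk] b; rewrite ?mulr1 // exprS mulrA => /IHk/Hs.
exists (fun k x => exists r, x = r * (a * s ^+ k)); split.
- move=> k; split; first by exists 0; rewrite mul0r.
    by move=> _ _ [r ->] [r' ->]; exists (r + r'); rewrite mulrDl.
  by move=> t _ [r ->]; exists (t * r); rewrite mulrA.
- by move=> k; exists (a * s ^+ k); [exists 1; rewrite mul1r | apply/eqP => /sX].
move=> m b Hb.
have /choice[r Hr] : forall k, exists r, (k < m)%N -> b k = r * (a * s ^+ k).
  by move=> k; case: (ltnP k m) => [/Hb[r ?]|_]; [exists r | exists 0].
move=> S0 k km; rewrite Hr // mulrA.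
have {}S0 : \sum_(k < m) r k * a * s ^+ k = 0.
  by rewrite -[RHS]S0; apply: eq_bigr => j _; rewrite Hr // mulrA.
suff -> : r k * a = 0 by rewrite mul0r.
elim: m k r km S0 {Hr Hb} => // m IHm k r km.
rewrite big_ord_recl mulr1; under eq_bigr do rewrite exprSr mulrA.
rewrite -mulr_suml => S0.
have ra0 : r 0 * a = 0.
  apply: contrapT => ra0; apply: Hno; exists (r 0); split=> //.
  by exists (- \sum_(i < m) r (bump 0 i) * a * s ^+ i); apply/eqP; rewrite mulNr -addr_eq0 S0.
move: S0; rewrite ra0 add0r => /Hs S0.
by case: k km => // k km; apply: (IHm k (fun i => r i.+1)).
Qed.

Section WithACC.
Hypotheses (sT : elt_semiprime T) (aT : ACC_lann T).

Lemma ACC_lann_max (P : T -> Prop) : (exists a, P a) ->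
  exists2 a, P a & forall b, P b -> (forall t, t * a = 0 -> t * b = 0) ->
    forall t, t * b = 0 -> t * a = 0.
Proof.
move=> [a0 Pa0]; apply: contrapT => Hno.
have [a Pa|f Hf] := @chain_choice T P (fun a b =>
    (forall t, t * a = 0 -> t * b = 0) /\ exists t, t * b = 0 /\ t * a <> 0) a0 Pa0.
  apply: contrapT => Hb; apply: Hno; exists a => // b Pb ab t tb0.
  apply: contrapT => ta0; apply: Hb; exists b; split=> //; split=> //; by exists t.
have [|N HN] := @aT (fun k => eq (f k)).
  by move=> k r Hr y <-; have [_ [H _]] := Hf k; apply/H/Hr.
have [_ [_ [t [tf tf0]]]] := Hf N; apply: tf0.
by apply/(HN N.+1 (leqnSn N) t).1 => // y <-.
Qed.

(** Among nonzero singular elements take [b] with maximal left annihilator. If [b * r * b] were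
    nonzero, its annihilator would equal that of [b]. But the annihilator of [r * b] is essential,
    hence contains some [t * b <> 0], and this [t] kills [b * r * b] without killing [b]. *)
Lemma semiprime_nonsingular : nonsingular.
Proof.
move=> a Ha; apply: contrapT => a0.
have [|b [Zb b0] bmax] := @ACC_lann_max (fun b => ess (fun t => t * b = 0) /\ b <> 0).
  by exists a.
apply: b0; apply: sT => r; apply: contrapT => brb0.
have Zrb : ess (fun t => t * (r * b) = 0).
  apply: ess_sub (@ess_preim _ r _ Zb) => [t|]; first by rewrite mulrA.
  by rewrite mul0r.
have [|t [tbrb tb0]] := Zrb b; first by move=> b0; apply: brb0; rewrite b0 mulr0.
apply: tb0; apply: (bmax (b * r * b)).
- by split=> //; apply: ess_sub Zb => u ub0; rewrite !mulrA ub0 !mul0r.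
- by move=> u ub0; rewrite !mulrA ub0 !mul0r.
- by rewrite -tbrb !mulrA.
Qed.

(* Either [L] contains a non-nilpotent element, a high power of which works, or
   [L] is nil, and then a maximal left annihilator yields [b * r * b = 0]. *)
Lemma ideal_stable_elt (L : T -> Prop) : left_ideal L -> (exists2 x, L x & x <> 0) ->
  exists a, [/\ L a, a <> 0 & forall t, t * a * a = 0 -> t * a = 0].
Proof.
move=> [_ _ LM] [x Lx x0].
have [[b [Lb bnil]]|Lnil] := pselect (exists b, L b /\ forall k, b ^+ k <> 0).
  have [|N HN] := @aT (fun k => eq (b ^+ k)).
    by move=> k r Hr y <-; rewrite exprSr mulrA Hr // mul0r.
  exists (b ^+ N.+1); split=> [||t tbb]; first by rewrite exprSr; apply: LM.
    exact: bnil.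
  have NN : (N <= N.+1 + N.+1)%N by rewrite addSn -addnS leq_addr.
  have tN : lann (eq (b ^+ N)) t.
    by apply/(HN _ NN) => y <-; rewrite exprD mulrA.
  by rewrite exprSr mulrA tN // mul0r.
have {}Lnil b : L b -> exists k, b ^+ k == 0.
  move=> Lb; apply: contrapT => Hk; apply: Lnil; exists b; split=> // k bk.
  by apply: Hk; exists k; apply/eqP.
have [|b [b0 [c bE]] bmax] := @ACC_lann_max (fun y => y <> 0 /\ exists r, y = x * r).
  by exists x; split=> //; exists 1; rewrite mulr1.
case: b0; apply: sT => r.
have XE k : (b * r) ^+ k.+1 = x * (c * r * x) ^+ k * (c * r).
  elim: k => [|k IHk]; first by rewrite expr1 mulr1 bE !mulrA.
  by rewrite exprSr IHk exprSr bE !mulrA.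
have [k kP kmin] : exists2 k, (b * r) ^+ k = 0 & forall j, (b * r) ^+ j = 0 -> (k <= j)%N.
  have ex : exists k, (b * r) ^+ k == 0.
    by have [k /eqP Hk] := Lnil _ (LM (c * r) x Lx); exists k.+1; rewrite XE Hk mulr0 mul0r.
  by case: (ex_minnP ex) => k /eqP kP kmin; exists k => // j /eqP /kmin.
case: k => [|[|k]] in kP kmin; first by rewrite -[LHS]mul1r -(expr0 (b * r)) kP mul0r.
  by rewrite -(expr1 (b * r)) kP mul0r.
apply: (bmax ((b * r) ^+ k.+1)); last by rewrite -exprS.
  split; first by move/kmin; rewrite ltnn.
  by rewrite XE; exists ((c * r * x) ^+ k * (c * r)); rewrite !mulrA.
by move=> t tb0; rewrite exprS !mulrA tb0 !mul0r.
Qed.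

(** The regular element is the sum [S] of a maximal independent list of stable elements of [E], each
    killing the earlier ones from the left. Maximality and [ideal_stable_elt] show that no nonzero
    element of [E] kills the whole list. By independence, whatever kills [S] from the left kills
    every member, so [S] has zero left annihilator. Then [T S] is essential, and nonsingularity
    gives the other side. *)
Lemma ess_regular (E : T -> Prop) : finite_left_udim T -> left_ideal E -> ess E ->
  exists2 s, E s & regular s.
Proof.
move=> fT lE eE; have [E0 ED EM] := lE.
pose stable a := forall t : T, t * a * a = 0 -> t * a = 0.
pose P := fix P s := if s is v :: s' then
  [/\ E v, stable v, forall w, w \in s' -> v * w = 0 & P s'] else True.
(* Triangularity peels off one summand at a time: the older part of [y] vanishes by induction,
   leaving [y = r * v] with [y * v = 0], where stability of [v] applies. *)
have Padj s y : P s -> adjoin zero_ideal s y -> (forall w, w \in s -> y * w = 0) -> y = 0.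
  elim: s y => [//|v s IHs] y /= [_ sv vs Ps] [r Hr] ys.
  have yrv : y - r * v = 0.
    apply: IHs => // w ws; rewrite mulrBl ys ?inE ?ws ?orbT //.
    by rewrite -mulrA vs // mulr0 subr0.
  have yE : y = r * v by apply/eqP; rewrite -subr_eq0; apply/eqP.
  by rewrite yE; apply: sv; rewrite -yE ys ?mem_head.
have [//|s [Ps sI smax]] := @udim_chain zero_ideal P fT left_ideal0.
pose L x := E x /\ forall w, w \in s -> x * w = 0.
have L0 x : L x -> x = 0.
  move=> Lx; apply: contrapT => x0.
  have [||v [[Ev vs] v0 sv]] := @ideal_stable_elt L; last 1 first.
  - have [//||r [Hr rv0]] := smax v; first by [].
    by apply: rv0; apply: (Padj s) => // w ws; rewrite -mulrA vs ?mulr0.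
  - split=> [|a b [Ea as0] [Eb bs0]|r a [Ea as0]].
    + by split=> // w _; rewrite mul0r.
    + by split=> [|w ws]; [apply: ED | rewrite mulrDl as0 // bs0 // addr0].
    + by split=> [|w ws]; [apply: EM | rewrite -mulrA as0 // mulr0].
  - by exists x.
pose S := \sum_(w <- s) w.
have ES : E S.
  rewrite /S; elim: s Ps {sI smax L L0 S} => [_|v s IHs /= [Ev _ _ Ps]].
    by rewrite big_nil.
  by rewrite big_cons; apply: ED; last exact: IHs.
have adjS t s' : adjoin zero_ideal s' (t * \sum_(w <- s') w).
  elim: s' => [|v s' IH] /=; first by rewrite big_nil mulr0.
  by exists t; rewrite big_cons mulrDr addrAC subrr add0r.
have tS t : t * S = 0 -> forall w, w \in s -> t * w = 0.
  rewrite /S; elim: s sI {Ps smax L L0 S ES} => [//|v s IHs] /= [_ vs sI].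
  rewrite big_cons mulrDr => tS0.
  have tv0 : t * v = 0.
    apply: vs; rewrite -[_ * v]opprK; apply: left_idealN.
      exact: adjoin_ideal left_ideal0.
    have -> : - (t * v) = t * \sum_(w <- s) w by apply/eqP; rewrite eq_sym -addr_eq0 addrC tS0.
    exact: adjS.
  move: tS0; rewrite tv0 add0r => tS0 w; rewrite inE => /orP[/eqP->//|].
  exact: IHs.
have lS b : b * S = 0 -> b = 0.
  move=> bS; apply: contrapT => /eE[t [Etb]]; apply; apply: L0; split=> // w ws.
  by rewrite -mulrA (tS b) // mulr0.
exists S => //; split=> // b Sb; apply: (nonsingular_ess semiprime_nonsingular (cancel_ess fT lS)).
by move=> _ [r ->]; rewrite -mulrA Sb mulr0.
Qed.

End WithACC.
End LeftGoldie.

Arguments zero_ideal {T} x.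
Arguments left_ideal0 {T}.

(** * The maximal left quotient ring and Goldie's theorem *)

(* Partial homomorphisms with essential domain are represented by their graphs.
   Closing a graph under [cl] gives the largest extension, so that equality in the
   quotient ring is equality of graphs. Maps act on the right, which makes
   [r |-> (a |-> a * r)] a ring morphism. *)
Section QuotientRing.
Variable T : pzRingType.
Hypothesis nT : nonsingular T.

Definition partial_hom (G : T -> T -> Prop) : Prop :=
  [/\ G 0 0, forall a b a' b', G a b -> G a' b' -> G (a + a') (b + b'),
      forall r a b, G a b -> G (r * a) (r * b),
      ess (fun a => exists b, G a b) & forall b, G 0 b -> b = 0].

Definition cl (G : T -> T -> Prop) (a b : T) : Prop :=
  ess (fun t => G (t * a) (t * b)).

Lemma clI G a b : partial_hom G -> G a b -> cl G a b.
Proof. by move=> [_ _ GM _ _] Gab t t0; exists 1; rewrite mul1r; split=> //; apply: GM. Qed.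

Lemma ess_nz (E : T -> Prop) u : ess E -> u <> 0 -> exists2 t, E t & t * u <> 0.
Proof.
move=> eE u0; apply: contrapT => Hno; apply: u0; apply: (nonsingular_ess nT eE) => t Et.
by apply: contrapT => tu0; apply: Hno; exists t.
Qed.

Lemma cl_partial G : partial_hom G -> partial_hom (cl G).
Proof.
move=> pG; have [G00 GD GM Gdom G0] := pG; split.
- exact: clI.
- move=> a b a' b' Gab Gab'; apply: ess_sub (ess_cap Gab _ Gab') => [t [Gt Gt']|r t Gt].
    by rewrite !mulrDr; apply: GD.
  by rewrite -!mulrA; apply: GM.
- move=> r a b Gab; apply: ess_sub (@ess_preim _ _ r _ Gab) => [t|]; first by rewrite -!mulrA.
  by rewrite !mul0r.
- by apply: ess_sub Gdom => a [b Gab]; exists b; apply: clI.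
- move=> b Gb; apply: (nonsingular_ess nT Gb) => t; rewrite mulr0; exact: G0.
Qed.

Lemma cl_closed G a b : partial_hom G -> cl (cl G) a b -> cl G a b.
Proof.
move=> _ cG u /cG[t [Gt tu0]].
have [v Gv vtu0] := ess_nz Gt tu0.
by exists (v * t); split; move: Gv vtu0; rewrite !mulrA.
Qed.

Record qmax : Type := QMax {
  qrel :> T -> T -> Prop;
  qrel_partial : partial_hom qrel;
  qrel_closed : forall a b, cl qrel a b -> qrel a b }.

Definition close G (pG : partial_hom G) : qmax :=
  QMax (cl_partial pG) (fun a b => @cl_closed G a b pG).

Lemma closeI G (pG : partial_hom G) a b : G a b -> close pG a b.
Proof. exact: clI. Qed.

Lemma qrelD (p : qmax) a b a' b' : p a b -> p a' b' -> p (a + a') (b + b').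
Proof. by case: (qrel_partial p) => _ + _ _ _; apply. Qed.

Lemma qrelM (p : qmax) r a b : p a b -> p (r * a) (r * b).
Proof. by case: (qrel_partial p) => _ _ + _ _; apply. Qed.

Lemma qrel00 (p : qmax) : p 0 0.
Proof. by case: (qrel_partial p). Qed.

Lemma qrel0 (p : qmax) b : p 0 b -> b = 0.
Proof. by case: (qrel_partial p) => _ _ _ _; apply. Qed.

Lemma qrel_fun (p : qmax) a b b' : p a b -> p a b' -> b = b'.
Proof.
move=> pb /(qrelM (-1)); rewrite !mulN1r => /(qrelD pb); rewrite subrr => /qrel0/eqP.
by rewrite subr_eq0 => /eqP.
Qed.

Lemma qrel_dom (p : qmax) : ess (fun a => exists b, p a b).
Proof. by case: (qrel_partial p). Qed.

Lemma qrel_domM (p : qmax) r a : (exists b, p a b) -> exists b, p (r * a) b.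
Proof. by move=> [b pb]; exists (r * b); apply: qrelM. Qed.

Lemma qmax_eq (p q : qmax) : ess (fun a => exists2 b, p a b & q a b) -> p = q.
Proof.
have half (p' q' : qmax) : ess (fun a => exists2 b, p' a b & q' a b) ->
    forall a b, p' a b -> q' a b.
  move=> e a b pab; apply: qrel_closed.
  apply: ess_sub (@ess_preim _ _ a _ e) => [t [c pc qc]|]; last first.
    by exists 0; apply: qrel00.
  by rewrite (qrel_fun (qrelM t pab) pc).
move=> e; have : qrel p = qrel q.
  apply: funext => a; apply: funext => b; apply: propext; split; first exact: half.
  by apply: half; apply: ess_sub e => c [d pd qd]; exists d.
case: p q {half e} => [G pG cG] [H pH cH] /= GH; case: H / GH in pH cH *.
by congr QMax; apply: Prop_irrelevance.
Qed.

Definition qadd_rel (p q : qmax) a c := exists b b', [/\ p a b, q a b' & c = b + b'].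
Definition qmul_rel (p q : qmax) a c := exists2 b, p a b & q b c.
Definition qopp_rel (p : qmax) a c := p a (- c).
Definition qemb_rel (r : T) a c := c = a * r.

Lemma qadd_partial p q : partial_hom (qadd_rel p q).
Proof.
split.
- by exists 0, 0; rewrite addr0; split=> //; apply: qrel00.
- move=> a _ a' _ [b [b' [p1 q1 ->]]] [d [d' [p2 q2 ->]]].
  by exists (b + d), (b' + d'); rewrite addrACA; split=> //; apply: qrelD.
- move=> r a _ [b [b' [p1 q1 ->]]].
  by exists (r * b), (r * b'); rewrite mulrDr; split=> //; apply: qrelM.
- apply: ess_sub (ess_cap (qrel_dom p) (@qrel_domM q) (qrel_dom q)) => a [[b pb] [b' qb]].
  by exists (b + b'), b, b'.
- by move=> _ [b [b' [/qrel0-> /qrel0-> ->]]]; rewrite addr0.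
Qed.

Lemma qmul_dom (p : qmax) (E : T -> Prop) : E 0 -> ess E ->
  ess (fun a => exists2 b, p a b & E b).
Proof.
move=> E0 eE a a0; have [t [[b pb] ta0]] := qrel_dom p a0.
have [u Eub uta0] := ess_nz (@ess_preim _ _ b E0 eE) ta0.
by exists (u * t); rewrite -mulrA; split=> //; exists (u * b) => //; apply: qrelM.
Qed.

Lemma qmul_partial p q : partial_hom (qmul_rel p q).
Proof.
split.
- by exists 0; apply: qrel00.
- by move=> a c a' c' [b p1 q1] [b' p2 q2]; exists (b + b'); apply: qrelD.
- by move=> r a c [b p1 q1]; exists (r * b); apply: qrelM.
- have := @qmul_dom p (fun b => exists c, q b c) _ (qrel_dom q).
  move=> /(_ (ex_intro _ 0 (qrel00 q))).
  by apply: ess_sub => a [b pb [c qc]]; exists c, b.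
- by move=> c [b /qrel0-> /qrel0].
Qed.

Lemma qopp_partial p : partial_hom (qopp_rel p).
Proof.
rewrite /qopp_rel; split.
- by rewrite oppr0; apply: qrel00.
- by move=> a b a' b'; rewrite opprD; apply: qrelD.
- by move=> r a b; rewrite -mulrN; apply: qrelM.
- by apply: ess_sub (qrel_dom p) => a [b pb]; exists (- b); rewrite opprK.
- by move=> b /qrel0/eqP; rewrite oppr_eq0 => /eqP.
Qed.

Lemma qemb_partial r : partial_hom (qemb_rel r).
Proof.
rewrite /qemb_rel; split.
- by rewrite mul0r.
- by move=> a _ a' _ -> ->; rewrite mulrDl.
- by move=> t a _ ->; rewrite mulrA.
- by move=> a a0; exists 1; rewrite mul1r; split=> //; exists (a * r).
- by move=> _ ->; rewrite mul0r.
Qed.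

Definition qadd p q := close (qadd_partial p q).
Definition qmul p q := close (qmul_partial p q).
Definition qopp p := close (qopp_partial p).
Definition qemb r := close (qemb_partial r).

Lemma qaddI (p q : qmax) a b b' : p a b -> q a b' -> qadd p q a (b + b').
Proof. by move=> pb qb; apply: closeI; exists b, b'. Qed.
Lemma qmulI (p q : qmax) a b c : p a b -> q b c -> qmul p q a c.
Proof. by move=> pb qc; apply: closeI; exists b. Qed.
Lemma qoppI (p : qmax) a b : p a b -> qopp p a (- b).
Proof. by move=> pb; apply: closeI; rewrite /qopp_rel opprK. Qed.
Lemma qembI r a : qemb r a (a * r).
Proof. by apply: closeI. Qed.
Lemma qemb0I a : qemb 0 a 0.
Proof. by rewrite -[X in qemb _ _ X](mulr0 a); apply: qembI. Qed.
Lemma qemb1I a : qemb 1 a a.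
Proof. by rewrite -[X in qemb _ _ X](mulr1 a); apply: qembI. Qed.

Lemma qrel_dom2 (p q : qmax) : ess (fun a => (exists b, p a b) /\ exists b, q a b).
Proof. exact: ess_cap (qrel_dom p) (@qrel_domM q) (qrel_dom q). Qed.

Fact qaddA : associative qadd.
Proof.
move=> p q r; apply: qmax_eq.
apply: ess_sub (ess_cap (qrel_dom2 p q) (@qrel_domM r) (qrel_dom r)).
move=> a [[[b pb] [c qc]] [d rd]]; exists (b + c + d).
  by rewrite -addrA; do 2!apply: qaddI => //.
by do 2!apply: qaddI => //.
Qed.

Fact qaddC : commutative qadd.
Proof.
move=> p q; apply: qmax_eq; apply: ess_sub (qrel_dom2 p q) => a [[b pb] [c qc]].
by exists (b + c); [|rewrite addrC]; apply: qaddI.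
Qed.

Fact qadd0 : left_id (qemb 0) qadd.
Proof.
move=> p; apply: qmax_eq; apply: ess_sub (qrel_dom p) => a [b pb].
by exists b => //; rewrite -[b]add0r; apply: qaddI => //; apply: qemb0I.
Qed.

Fact qaddN : left_inverse (qemb 0) qopp qadd.
Proof.
move=> p; apply: qmax_eq; apply: ess_sub (qrel_dom p) => a [b pb].
by exists 0; [rewrite -(addNr b); apply: qaddI => //; apply: qoppI | apply: qemb0I].
Qed.

Fact qmulA : associative qmul.
Proof.
move=> p q r; apply: qmax_eq.
have [qr0 _ _ qrD _] := qmul_partial q r.
have := @qmul_dom p (fun b => exists c, qmul_rel q r b c) (ex_intro _ 0 qr0) qrD.
apply: ess_sub => a [b pb [d [c qc rd]]]; exists d.
  by apply: (qmulI pb); apply: qmulI rd.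
by apply: (qmulI _ rd); apply: qmulI qc.
Qed.

Fact qmul1q : left_id (qemb 1) qmul.
Proof.
move=> p; apply: qmax_eq; apply: ess_sub (qrel_dom p) => a [b pb].
by exists b => //; apply: qmulI pb; apply: qemb1I.
Qed.

Fact qmulq1 : right_id (qemb 1) qmul.
Proof.
move=> p; apply: qmax_eq; apply: ess_sub (qrel_dom p) => a [b pb].
by exists b => //; apply: (qmulI pb); apply: qemb1I.
Qed.

Fact qmulDl : left_distributive qmul qadd.
Proof.
move=> p q r; apply: qmax_eq.
have [_ _ pM pD _] := qmul_partial p r; have [_ _ qM qD _] := qmul_partial q r.
have MM t a : (exists b, qmul_rel q r a b) -> exists b, qmul_rel q r (t * a) b.
  by move=> [b ?]; exists (t * b); apply: qM.
apply: ess_sub (ess_cap pD MM qD) => a [[d [b pb rd]] [d' [b' qb rd']]].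
exists (d + d').
  by apply: (qmulI (qaddI pb qb)); apply: qrelD.
by apply: qaddI; [apply: qmulI rd | apply: qmulI rd'].
Qed.

Fact qmulDr : right_distributive qmul qadd.
Proof.
move=> p q r; apply: qmax_eq.
have z0 : (exists b, q 0 b) /\ (exists b, r 0 b).
  by split; exists 0; apply: qrel00.
apply: ess_sub (@qmul_dom p _ z0 (qrel_dom2 q r)) => a [b pb [[c qc] [d rd]]].
exists (c + d); first by apply: (qmulI pb); apply: qaddI.
by apply: qaddI; apply: (qmulI pb).
Qed.

(* [nT] must occur in the type for the ring structure to be inferred from it. *)
Definition qring : Type := let _ := nT in qmax.
Definition qring_emb (r : T) : qring := qemb r.

HB.instance Definition _ := gen_eqMixin qring.
HB.instance Definition _ := gen_choiceMixin qring.
HB.instance Definition _ := GRing.isPzRing.Build qring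
  qaddA qaddC qadd0 qaddN qmulA qmul1q qmulq1 qmulDl qmulDr.

Fact qemb_zmod : zmod_morphism qring_emb.
Proof.
move=> r s; apply: qmax_eq => a a0; exists 1; rewrite mul1r; split=> //.
exists (a * (r - s)); first exact: qembI.
by rewrite mulrBr; apply: qaddI; [exact: qembI | apply: qoppI; exact: qembI].
Qed.

Fact qemb_monoid : monoid_morphism qring_emb.
Proof.
split=> // r s; apply: qmax_eq => a a0; exists 1; rewrite mul1r; split=> //.
exists (a * (r * s)); first exact: qembI.
by rewrite mulrA; apply: (qmulI (qembI _ _)); apply: qembI.
Qed.

HB.instance Definition _ := GRing.isZmodMorphism.Build T qring qring_emb qemb_zmod.
HB.instance Definition _ := GRing.isMonoidMorphism.Build T qring qring_emb qemb_monoid.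

Lemma qemb_inj : injective qring_emb.
Proof.
move=> r s rs; have := qembI r 1; rewrite -[qemb r]/(qring_emb r) rs mul1r => er.
by have := qrel_fun er (qembI s 1); rewrite mul1r.
Qed.

Lemma qemb_invertible s : finite_left_udim T -> regular s -> invertible (qring_emb s).
Proof.
move=> fT [sl sr].
(* The inverse of [s] is right division by [s], defined on the essential left ideal [T s]. *)
pose G a c := a = c * s.
have pG : partial_hom G.
  rewrite /G; split; first by rewrite mul0r.
  - by move=> _ b _ b' -> ->; rewrite mulrDl.
  - by move=> r _ b ->; rewrite mulrA.
  - exact: cancel_ess.
  - by move=> b /esym/sr.
exists (close pG); split; apply: qmax_eq.
  apply: ess_sub (cancel_ess fT sr) => a [b ab]; exists a; last exact: qemb1I.
  by apply: (qmulI (b := b)); [apply: closeI | rewrite ab; apply: qembI].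
move=> a a0; exists 1; rewrite mul1r; split=> //; exists a; last exact: qemb1I.
by apply: (qmulI (qembI s a)); apply: closeI.
Qed.

(** Any element of the domain of [q] serves as a denominator, so a regular element of the essential
    domain turns [q] into a fraction. *)
Lemma qemb_fraction (q : qring) s b : qrel q s b -> qring_emb s * q = qring_emb b.
Proof.
move=> qs; apply: qmax_eq => a a0; exists 1; rewrite mul1r; split=> //.
exists (a * b); last exact: qembI.
by apply: (qmulI (qembI _ _)); apply: qrelM.
Qed.

End QuotientRing.

Section Adjoin.
Variable T : pzRingType.
Implicit Types (I : T -> Prop) (s : seq T) (x : T).

Lemma adjoin_mono I I' s x : (forall y, I y -> I' y) -> adjoin I s x -> adjoin I' s x.
Proof.
move=> II'; elim: s x => [|v s IHs] x /=; first exact: II'.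
by move=> [r /IHs]; exists r.
Qed.

Lemma adjoin_decomp I s x : adjoin I s x -> exists k, I (x - k) /\ adjoin zero_ideal s k.
Proof.
elim: s x => [|v s IHs] x /=; first by exists 0; rewrite subr0.
move=> [r /IHs[k [Ik sk]]]; exists (k + r * v); rewrite opprD addrA addrAC; split=> //.
by exists r; rewrite addrK.
Qed.

Lemma indep_cap I s x : left_ideal I -> indep I s -> adjoin zero_ideal s x -> I x -> x = 0.
Proof.
move=> lI; elim: s x => [//|v s IHs] x /= [_ vs sI] [r xrv] Ix.
suff rv0 : r * v = 0 by move: xrv; rewrite rv0 subr0 => /IHs; apply.
apply: vs; have -> : r * v = x - (x - r * v) by rewrite subKr.
apply: left_idealB; [exact: adjoin_ideal | exact: adjoin_base |].
by apply: adjoin_mono xrv => _ ->; case: lI.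
Qed.

End Adjoin.

Section GoldieTheorem.
Variable T : pzRingType.
Hypotheses (sT : elt_semiprime T) (gT : left_goldie T).

(** Let [I] be the preimage of [L]. A maximal list independent over [I] makes the sum essential, so
    it contains a regular [u = (u - k) + k] with [u - k] in [I] and [k] in the span of the list.
    Then [Q (phi k)] is the complement: [phi u] is a unit, and clearing denominators reduces the
    intersection to that of [I] with the span. *)
Lemma quotient_semisimple (Q : pzRingType) (phi : {rmorphism T -> Q}) :
  is_left_quotient_ring phi -> semisimple_ring Q.
Proof.
move=> [_ phiU phiF] L lL; have [aT fT] := gT.
have [L0 LD LM] := lL.
pose I x := L (phi x).
have lI : left_ideal I.
  by split=> [|a b|r a]; rewrite /I ?rmorph0 ?rmorphD ?rmorphM //; [apply: LD | apply: LM].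
have [//|s [_ sI smax]] := @udim_chain _ I (fun=> True) fT lI.
have lIs := adjoin_ideal s lI.
have [|u Iu ru] := ess_regular sT aT fT lIs.
  by move=> a /smax[]// r Hr; exists r.
have [k [Iuk sk]] := adjoin_decomp Iu.
pose L' q := exists p, q = p * phi k.
exists L'; split; last split.
- split; first by exists 0; rewrite mul0r.
    by move=> _ _ [p ->] [p' ->]; exists (p + p'); rewrite mulrDl.
  by move=> r _ [p ->]; exists (r * p); rewrite mulrA.
- move=> _ /[swap] -[p ->] Lpk; have [t [a [rt tpa]]] := phiF p.
  have [w [wt _]] := phiU t rt.
  have ak0 : a * k = 0.
    apply: (indep_cap lI sI); first by case: (adjoin_ideal s left_ideal0) => _ _; apply.
    by rewrite /I rmorphM -tpa -mulrA; apply: LM.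
  by rewrite -[LHS]mul1r -wt -mulrA (mulrA (phi t)) tpa -rmorphM ak0 rmorph0 mulr0.
- move=> q; have [w [wu _]] := phiU u ru.
  exists (q * w * phi (u - k)), (q * w * phi k); split; first exact: LM.
  split; first by exists (q * w).
  by rewrite -mulrDr -rmorphD subrK -mulrA wu mulr1.
Qed.

Lemma left_goldie_theorem : Ql_exists_semisimple T.
Proof.
have [aT fT] := gT; have nT := semiprime_nonsingular sT aT.
have qQ : is_left_quotient_ring (qring_emb nT : {rmorphism T -> qring nT}).
  split; [exact: qemb_inj | by move=> s; apply: qemb_invertible |] => q.
  have [||s [b qs] rs] := @ess_regular T sT aT (fun a => exists b, qrel q a b) fT.
  - split; [by exists 0; apply: qrel00 | | exact: qrel_domM].
    by move=> a a' [b qa] [b' qa']; exists (b + b'); apply: qrelD.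
  - exact: qrel_dom.
  by exists s, b; split=> //; apply: qemb_fraction.
by exists (qring nT), (qring_emb nT); split=> //; apply: quotient_semisimple qQ.
Qed.

End GoldieTheorem.

(** * Left-right symmetry of semisimplicity *)

Section SemisimpleSymmetry.
Variable Q : pzRingType.
Hypothesis ssQ : semisimple_ring Q.

(** Splitting [1 = z * b + w] along [Q b] and a complement puts [b * w = b - b * z * b] in both. *)
Lemma semisimple_vnr (b : Q) : exists z, b * z * b = b.
Proof.
have [|L' [lL' [cap split1]]] := ssQ (L := fun x => exists r, x = r * b).
  split=> [|_ _ [r ->] [s ->]|t _ [r ->]]; first by exists 0; rewrite mul0r.
    by exists (r + s); rewrite mulrDl.
  by exists (t * r); rewrite mulrA.
have [_ [w [[z ->] [L'w one]]]] := split1 1; exists z.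
have L'M : L' (b * w) by case: lL' => _ _; apply.
have bE : b * w = b - b * z * b.
  by apply/eqP; rewrite eq_sym subr_eq -{1}(mulr1 b) one mulrDr mulrA addrC.
apply/eqP; rewrite eq_sym -subr_eq0 -bE; apply/eqP; apply: cap => //.
by exists (1 - b * z); rewrite bE mulrBl mul1r.
Qed.

Lemma semisimple_acc (L : nat -> Q -> Prop) :
  (forall k, left_ideal (L k)) -> (forall k x, L k x -> L k.+1 x) ->
  exists N, forall k x, L k x -> L N x.
Proof.
move=> lL Lmono.
have {}Lmono j k : (j <= k)%N -> forall x, L j x -> L k x.
  move=> /subnK <-; elim: (k - j)%N => // i IHi x Hx.
  by rewrite addSn; apply: Lmono; apply: IHi.
have [|L' [lL' [cap split1]]] := ssQ (L := fun x => exists k, L k x).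
  split=> [|a b [j La] [k Lb]|r a [k La]]; first by exists 0; case: (lL 0).
    exists (maxn j k); have [_ LD _] := lL (maxn j k).
    by apply: LD; [apply: Lmono La; rewrite leq_maxl | apply: Lmono Lb; rewrite leq_maxr].
  by exists k; have [_ _] := lL k; apply.
have [e [w [[N LNe] [L'w one]]]] := split1 1.
exists N => k x Lx.
suff -> : x = x * e by have [_ _] := lL N; apply.
have xw : x * w = x - x * e.
  by apply/eqP; rewrite eq_sym subr_eq -{1}(mulr1 x) one mulrDr addrC.
apply/eqP; rewrite -subr_eq0 -xw; apply/eqP; apply: cap; last by case: lL' => _ _; apply.
exists (maxn k N); rewrite xw; apply: left_idealB => //.
  by apply: Lmono Lx; rewrite leq_maxl.
by have [_ _] := lL (maxn k N); apply; apply: Lmono LNe; rewrite leq_maxr.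
Qed.

(* An idempotent [e] of the right ideal [J] that is not a generator can be
   enlarged to an idempotent [g] of [J] with [e = e * g]; then [Q e] is strictly
   contained in [Q g], so the ascending chain condition on left ideals applies. *)
Lemma right_ideal_complement (J : Q -> Prop) : right_ideal J -> exists J',
  right_ideal J' /\ (forall a, J a -> J' a -> a = 0) /\
  (forall q, exists a b, J a /\ J' b /\ q = a + b).
Proof.
move=> [J0 JD JM].
suff [e [Je [ee eJ]]] : exists e : Q, J e /\ e * e = e /\ forall a : Q, J a -> e * a = a.
  exists (fun x : Q => e * x = 0); split.
    split=> [|a b ea eb|r a ea]; first exact: mulr0.
      by rewrite mulrDr ea eb addr0.
    by rewrite mulrA ea mul0r.
  split=> [a /eJ {2}<- //|q].
  exists (e * q), (q - e * q); split; first exact: JM.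
  by rewrite mulrBr mulrA ee subrr addrC subrK.
apply: contrapT => Hno.
have [||f Hf] := @chain_choice Q (fun e => J e /\ e * e = e)
  (fun e g => e = e * g /\ ~ exists q, g = q * e) 0.
- by rewrite mul0r.
- move=> e [Je ee]; apply: contrapT => Hg; apply: Hno; exists e; split=> //; split=> // a Ja.
  apply: contrapT => ea; apply: Hg.
  pose b := a - e * a.
  have JN (x : Q) : J x -> J (- x) by move=> /(JM (-1)); rewrite mulrN1.
  have Jb : J b by apply: JD => //; apply: JN; apply: JM.
  have eb : e * b = 0 by rewrite mulrBr mulrA ee subrr.
  have [z bz] := semisimple_vnr b; pose f := b * z.
  have ff : f * f = f by rewrite /f mulrA bz.
  have ef : e * f = 0 by rewrite /f mulrA eb mul0r.
  (* Only [e * f = 0] is known; subtracting [f * e] makes the second summand an idempotent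
     orthogonal to [e] on both sides. *)
  pose g := e + (f - f * e).
  have eg : e * g = e by rewrite /g !mulrDr mulrN mulrA ee ef mul0r subr0 addr0.
  have fg : f * g = f by rewrite /g !mulrDr mulrN (mulrA f f) ff addrC subrK.
  exists g; split; [split|split].
  + by apply: (JD) => //; apply: JD; [|apply: JN; apply: (JM)]; apply: JM.
  + by rewrite -/g {1}/g mulrDl mulrBl -(mulrA f) eg fg.
  + by rewrite -/g eg.
  move=> [q gE]; apply: ea; apply/eqP; rewrite eq_sym -subr_eq0 -/b; apply/eqP.
  have ge : g * e = g by rewrite gE -mulrA ee.
  have fe : f = f * e.
    apply/eqP; rewrite -subr_eq0; apply/eqP; apply: (@addrI _ e).
    by rewrite -/g -ge /g addr0 mulrDl mulrBl -(mulrA f) ee subrr addr0.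
  by rewrite -bz -/f fe -mulrA eb mulr0.
have [||N HN] := @semisimple_acc (fun k x => exists q, x = q * f k).
- move=> k; split=> [|_ _ [r ->] [s ->]|t _ [r ->]]; first by exists 0; rewrite mul0r.
    by exists (r + s); rewrite mulrDl.
  by exists (t * r); rewrite mulrA.
- by move=> k _ [q ->]; have [_ [fE _]] := Hf k; exists (q * f k); rewrite -mulrA -fE.
have [_ [_]] := Hf N; apply; apply: (HN N.+1).
by exists 1; rewrite mul1r.
Qed.

Lemma semisimple_conv : semisimple_ring Q^c.
Proof. exact: right_ideal_complement. Qed.

End SemisimpleSymmetry.

Lemma right_goldie_theorem (T : pzRingType) :
  elt_semiprime T -> right_goldie T -> Qr_exists_semisimple T.
Proof.
move=> sT gT; have sTc := elt_semiprime_conv sT.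
have [Q [phi [[phi_inj phiU phiF] ssQ]]] := @left_goldie_theorem T^c sTc gT.
pose psi : T -> Q^c := phi.
have psiB : zmod_morphism psi by move=> a b; apply: (rmorphB phi).
have psiM : monoid_morphism psi.
  by split=> [|a b]; [apply: (rmorph1 phi) | apply: (rmorphM phi b a)].
pose psiA := GRing.isZmodMorphism.Build _ _ psi psiB.
pose psiMM := GRing.isMonoidMorphism.Build _ _ psi psiM.
pose psi' : {rmorphism T -> Q^c} := HB.pack psi psiA psiMM.
exists Q^c, psi'; split; last exact: semisimple_conv.
split=> [//|s [sl sr]|q].
  have [|v [vl vr]] := phiU s; first by split.
  by exists v.
by have [s [a [[sl sr] sE]]] := phiF q; exists s, a.
Qed.

(** * Leading terms *)

Section LeftSpan.
Variables (R A : pzRingType) (emb : {rmorphism R -> A}) (n : nat) (y : 'X_{1..n} -> A).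
Implicit Types (P Q : pred 'X_{1..n}) (g h : 'X_{1..n}) (r s : R) (a b : A).

Definition lspan P a : Prop := exists (s : seq 'X_{1..n}) (c : 'X_{1..n} -> R),
  [/\ uniq s, all P s & a = \sum_(g <- s) emb (c g) * y g].

Lemma sum_widen (s t : seq 'X_{1..n}) (c : 'X_{1..n} -> R) :
  uniq s -> uniq t -> {subset s <= t} ->
  \sum_(g <- s) emb (c g) * y g
  = \sum_(g <- t) emb (if g \in s then c g else 0) * y g.
Proof.
move=> us ut st.
have pst : perm_eq s [seq g <- t | g \in s].
  apply: uniq_perm => //; first exact: filter_uniq.
  by move=> g; rewrite mem_filter; case: (boolP (g \in s)) => // /st->.
rewrite (perm_big _ pst) big_filter big_mkcond; apply: eq_bigr => g _.
by case: ifP => // _; rewrite rmorph0 mul0r.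
Qed.

Lemma lspan1 P g r : P g -> lspan P (emb r * y g).
Proof.
by move=> Pg; exists [:: g], (fun=> r); rewrite /= Pg big_cons big_nil addr0.
Qed.

Lemma lspan_submod P : submod emb (lspan P).
Proof.
split.
- by exists [::], (fun=> 0); rewrite big_nil.
- move=> a b [s [c [us Ps ->]]] [t [d [ut Pt ->]]].
  exists (undup (s ++ t)), (fun g => (if g \in s then c g else 0) + (if g \in t then d g else 0)).
  split; first exact: undup_uniq.
    apply/allP => g; rewrite mem_undup mem_cat => /orP[/(allP Ps)//|/(allP Pt)//].
  rewrite (sum_widen (t := undup (s ++ t)) c) ?undup_uniq //; last first.
    by move=> g gs; rewrite mem_undup mem_cat gs.
  rewrite [X in _ + X](sum_widen (t := undup (s ++ t)) d) ?undup_uniq //; last first.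
    by move=> g gs; rewrite mem_undup mem_cat gs orbT.
  by rewrite -big_split; apply: eq_bigr => g _; rewrite rmorphD mulrDl.
- move=> r a [s [c [us Ps ->]]]; exists s, (fun g => r * c g); split=> //.
  by rewrite mulr_sumr; apply: eq_bigr => g _; rewrite rmorphM mulrA.
Qed.

Lemma lspan0 P : lspan P 0. Proof. by case: (lspan_submod P). Qed.
Lemma lspanD P a b : lspan P a -> lspan P b -> lspan P (a + b).
Proof. by case: (lspan_submod P) => _ + _; apply. Qed.
Lemma lspanZ P r a : lspan P a -> lspan P (emb r * a).
Proof. by case: (lspan_submod P) => _ _; apply. Qed.
Lemma lspanN P a : lspan P a -> lspan P (- a).
Proof. exact: submodN (lspan_submod P). Qed.
Lemma lspanB P a b : lspan P a -> lspan P b -> lspan P (a - b).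
Proof. exact: submodB (lspan_submod P). Qed.

Lemma lspan_ind P (K : A -> Prop) : K 0 -> (forall a b, K a -> K b -> K (a + b)) ->
  (forall g r, P g -> K (emb r * y g)) -> forall a, lspan P a -> K a.
Proof.
move=> K0 KD K1 _ [s [c [us /allP Ps ->]]]; rewrite big_seq_cond.
by apply: big_ind => // g /andP[/Ps Pg _]; apply: K1.
Qed.

Lemma lspan_mono P Q a : (forall g, P g -> Q g) -> lspan P a -> lspan Q a.
Proof.
move=> PQ; apply: lspan_ind; [exact: lspan0 | exact: lspanD |].
by move=> g r /PQ; apply: lspan1.
Qed.

Lemma lspan_split P Q a g : lspan P a -> (forall h, P h -> h = g \/ Q h) ->
  exists r, lspan Q (a - emb r * y g).
Proof.
move=> Pa PQ; elim/lspan_ind: Pa => [|b c [r Hb] [s Hc]|h r /PQ[->|Qh]].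
- by exists 0; rewrite rmorph0 mul0r subr0; apply: lspan0.
- by exists (r + s); rewrite rmorphD mulrDl opprD addrACA; apply: lspanD.
- by exists r; rewrite subrr; apply: lspan0.
- by exists 0; rewrite rmorph0 mul0r subr0; apply: lspan1.
Qed.

Definition lt_exp g : pred 'X_{1..n} := fun h => (h < g)%O.
Definition le_exp g : pred 'X_{1..n} := fun h => (h <= g)%O.

(** The coefficient [r] may be zero, so leading data add and multiply without any case distinction
    on cancellation. *)
Definition lead a g r : Prop := lspan (lt_exp g) (a - emb r * y g).

Lemma lead_le a g r : lead a g r -> lspan (le_exp g) a.
Proof.
move=> la; rewrite -[a](subrK (emb r * y g)); apply: lspanD.
  by apply: lspan_mono la => h /ltW.
by apply: lspan1; apply: lexx.
Qed.

Lemma lt_lead a g : lspan (lt_exp g) a -> lead a g 0.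
Proof. by rewrite /lead rmorph0 mul0r subr0. Qed.

Lemma lead_self g r : lead (emb r * y g) g r.
Proof. by rewrite /lead subrr; apply: lspan0. Qed.

Lemma leadD a b g r s : lead a g r -> lead b g s -> lead (a + b) g (r + s).
Proof. by move=> la lb; rewrite /lead rmorphD mulrDl opprD addrACA; apply: lspanD. Qed.

Lemma leadZ a g r s : lead a g r -> lead (emb s * a) g (s * r).
Proof. by move=> la; rewrite /lead rmorphM -mulrA -mulrBr; apply: lspanZ. Qed.

Lemma exp_max (I : eqType) (f : I -> 'X_{1..n}) (s : seq I) :
  s <> [::] -> exists2 i, i \in s & forall j, j \in s -> (f j <= f i)%O.
Proof.
elim: s => [//|i s IHs] _; have [->|/eqP/IHs[j js jmax]] := eqVneq s [::].
  by exists i; rewrite ?mem_head // => j; rewrite inE => /eqP->.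
case: (leP (f i) (f j)) => [fij|/ltW fji].
  by exists j; [rewrite inE js orbT | move=> k; rewrite inE => /orP[/eqP->//|/jmax]].
exists i; first exact: mem_head.
by move=> k; rewrite inE => /orP[/eqP->//|/jmax/le_trans]; apply.
Qed.

Lemma lspan_lead P a : lspan P a -> a <> 0 -> exists g r, [/\ P g, r <> 0 & lead a g r].
Proof.
move=> [s [c [us /allP Ps aE]]] a0.
have aE' : a = \sum_(g <- [seq g <- s | c g != 0]) emb (c g) * y g.
  rewrite aE big_filter [RHS]big_mkcond; apply: eq_bigr => g _.
  by have [->|//] := eqVneq (c g) 0; rewrite rmorph0 mul0r.
have [|g] := @exp_max _ id [seq g <- s | c g != 0].
  by move=> s0; apply: a0; rewrite aE' s0 big_nil.
rewrite mem_filter => /andP[/eqP cg gs] gmax; exists g, (c g); split=> //; first exact: Ps.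
rewrite /lead aE' (big_rem g) /=; last by rewrite mem_filter gs andbT; apply/eqP.
rewrite addrAC subrr add0r big_seq_cond; apply: big_ind; [exact: lspan0 | exact: lspanD |].
move=> h /andP[]; rewrite mem_rem_uniq ?filter_uniq // inE => /andP[hg hs] _.
by apply: lspan1; rewrite /lt_exp lt_neqAle hg gmax.
Qed.

End LeftSpan.

(* The exponents are ordered by [mpoly]'s degree-lexicographic order; [sig g]
   is the twist of the coefficients by the monomial [y g]. *)
Record pbw (R A : pzRingType) (emb : {rmorphism R -> A}) (n : nat)
    (y : 'X_{1..n} -> A) (sig : 'X_{1..n} -> R -> R) : Prop := Pbw {
  pbw_free : forall (s : seq 'X_{1..n}) (c : 'X_{1..n} -> R), uniq s ->
    \sum_(g <- s) emb (c g) * y g = 0 -> forall g, g \in s -> c g = 0;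
  pbw_span : forall a, lspan emb y predT a;
  pbw_comm : forall g r, lead emb y (y g * emb r) g (sig g r);
  pbw_inj : forall g, injective (sig g);
  pbw_surj : forall g s, exists r, sig g r = s;
  pbw_mul : forall g h, exists c, invertible c /\ lead emb y (y g * y h) (g + h)%MM c }.

Section Pbw.
Variables (R A : pzRingType) (emb : {rmorphism R -> A}) (n : nat).
Variables (y : 'X_{1..n} -> A) (sig : 'X_{1..n} -> R -> R).
Hypothesis H : pbw emb y sig.
Implicit Types (g h : 'X_{1..n}) (r s c : R) (a b : A).
Local Notation lspan := (lspan emb y).
Local Notation lead := (lead emb y).

Lemma lt_top0 (P : pred 'X_{1..n}) g r : ~~ P g -> lspan P (emb r * y g) -> r = 0.
Proof.
move=> Pg [s [c [us Ps E]]].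
have gs : g \notin s by apply: contra Pg => /(allP Ps).
have := pbw_free H (s := g :: s) (c := fun h => if h == g then - r else c h).
move=> /= /(_ _ _ g); rewrite eqxx mem_head gs us => F.
apply/eqP; rewrite -oppr_eq0; apply/eqP; apply: F => //.
rewrite big_cons eqxx rmorphN mulNr E; apply/eqP; rewrite addrC subr_eq0; apply/eqP.
by apply: eq_big_seq => h hs; case: eqP => // hg; rewrite -hg hs in gs.
Qed.

Lemma lead_uniq a g r s : lead a g r -> lead a g s -> r = s.
Proof.
move=> lr ls; apply/eqP; rewrite -subr_eq0; apply/eqP.
apply: (@lt_top0 (lt_exp g) g); first by rewrite /lt_exp ltxx.
have := lspanB ls lr; rewrite opprB addrC addrA subrK.
by rewrite rmorphB mulrBl.
Qed.

Lemma lead_nz a g r : lead a g r -> r <> 0 -> a <> 0.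
Proof.
move=> la r0 a0; apply: r0; apply: lead_uniq la _; rewrite a0; apply: lt_lead.
exact: lspan0.
Qed.

Lemma lead_exists a : a <> 0 -> exists g r, r <> 0 /\ lead a g r.
Proof. by move=> /(lspan_lead (pbw_span H a))[g [r [_ ? ?]]]; exists g, r. Qed.

Lemma lspan_mul (P Q S : pred 'X_{1..n}) a b :
  (forall g h, P g -> Q h -> forall k, (k <= (g + h)%MM)%O -> S k) ->
  lspan P a -> lspan Q b -> lspan S (a * b).
Proof.
move=> PQS Pa Qb; elim/lspan_ind: Pa => [|a1 a2|g r Pg].
- by rewrite mul0r; apply: lspan0.
- by rewrite mulrDl; apply: lspanD.
elim/lspan_ind: Qb => [|b1 b2|h s Qh].
- by rewrite mulr0; apply: lspan0.
- by rewrite mulrDr; apply: lspanD.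
have [c [_ /lead_le gh]] := pbw_mul H g h.
rewrite -mulrA; apply: lspanZ; rewrite mulrA.
have : lspan (le_exp g) (y g * emb s) by apply: lead_le (pbw_comm H g s).
elim/lspan_ind => [|a1 a2|k t kg].
- by rewrite mul0r; apply: lspan0.
- by rewrite mulrDl; apply: lspanD.
have [d [_ /lead_le kh]] := pbw_mul H k h.
rewrite -mulrA; apply: lspanZ; apply: lspan_mono kh => m mkh; apply: (PQS g h) => //.
by apply: le_trans mkh _; rewrite lemc_add2l.
Qed.

Lemma lspan_le_mul g h a b :
  lspan (le_exp g) a -> lspan (le_exp h) b -> lspan (le_exp (g + h)%MM) (a * b).
Proof.
apply: lspan_mul => g' h' g'g h'h k /le_trans; apply; exact: lem_add.
Qed.

Lemma lspan_ltl_mul g h a b :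
  lspan (lt_exp g) a -> lspan (le_exp h) b -> lspan (lt_exp (g + h)%MM) (a * b).
Proof.
apply: lspan_mul => g' h' g'g h'h k /le_lt_trans; apply; exact: ltmc_le_add.
Qed.

Lemma lspan_ltr_mul g h a b :
  lspan (le_exp g) a -> lspan (lt_exp h) b -> lspan (lt_exp (g + h)%MM) (a * b).
Proof.
apply: lspan_mul => g' h' g'g h'h k /le_lt_trans; apply; exact: lemc_lt_add.
Qed.

Lemma lead_mulr a g r s : lead a g r -> lead (a * emb s) g (r * sig g s).
Proof.
move=> la; have -> : a * emb s = (a - emb r * y g) * emb s + emb r * (y g * emb s).
  by rewrite mulrBl mulrA subrK.
rewrite -[r * _]add0r; apply: leadD; last by apply: leadZ; apply: pbw_comm.
apply: lt_lead; elim/lspan_ind: la => [|b1 b2|h t hg].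
- by rewrite mul0r; apply: lspan0.
- by rewrite mulrDl; apply: lspanD.
rewrite -mulrA; apply: lspanZ; apply: lspan_mono (lead_le (pbw_comm H h s)) => k kh.
exact: le_lt_trans hg.
Qed.

Lemma lead_mul a b g h r s c : lead (y g * y h) (g + h)%MM c ->
  lead a g r -> lead b h s -> lead (a * b) (g + h)%MM (r * sig g s * c).
Proof.
move=> lgh la lb.
have -> : a * b = a * (b - emb s * y h)
    + ((a - emb r * y g) * (emb s * y h) + emb r * (y g * emb s * y h)).
  rewrite mulrBl mulrBr -!mulrA; set u := a * (emb s * _); set v := emb r * _.
  by rewrite [u - v + v]subrK subrK.
have -> : r * sig g s * c = 0 + (0 + r * (sig g s * c)) by rewrite !add0r mulrA.
apply: leadD; first by apply: lt_lead; apply: lspan_ltr_mul => //; apply: lead_le la.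
apply: leadD.
  by apply: lt_lead; apply: lspan_ltl_mul => //; apply: lead_le (lead_self _ _ h s).
apply: leadZ.
have -> : y g * emb s * y h = (y g * emb s - emb (sig g s) * y g) * y h
    + emb (sig g s) * (y g * y h) by rewrite mulrBl mulrA subrK.
rewrite -[_ * c]add0r; apply: leadD; last exact: leadZ.
apply: lt_lead; apply: lspan_ltl_mul; first exact: pbw_comm.
by rewrite -[y h]mul1r -(rmorph1 emb); apply: lspan1; apply: lexx.
Qed.

Lemma lead_y g : lead (y g) g 1.
Proof. by rewrite -[y g]mul1r -(rmorph1 emb); apply: lead_self. Qed.

(** [pbw] postulates only that the twists are bijective; their algebraic laws come from computing
    one leading coefficient in two ways. *)
Lemma sigM g r s : sig g (r * s) = sig g r * sig g s.
Proof.
apply: (@lead_uniq (y g * emb r * emb s) g).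
  by rewrite -mulrA -rmorphM; apply: pbw_comm.
by apply: lead_mulr; apply: pbw_comm.
Qed.

Lemma sig0 g : sig g 0 = 0.
Proof.
apply: (@lead_uniq (y g * emb 0) g); first exact: pbw_comm.
by rewrite rmorph0 mulr0; apply: lt_lead; apply: lspan0.
Qed.

Lemma sig1 g : sig g 1 = 1.
Proof.
apply: (@lead_uniq (y g * emb 1) g); first exact: pbw_comm.
by rewrite rmorph1 mulr1; apply: lead_y.
Qed.

Lemma sig_eq0 g r : sig g r = 0 -> r = 0.
Proof. by move=> s0; apply: (pbw_inj H (g := g)); rewrite s0 sig0. Qed.

(** Twists compose only up to conjugation by the unit [c] of the product of monomials. *)
Lemma sig_comp g h r c : lead (y g * y h) (g + h)%MM c ->
  sig g (sig h r) * c = c * sig (g + h)%MM r.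
Proof.
move=> lgh; apply: (@lead_uniq (y g * y h * emb r) (g + h)%MM); last exact: lead_mulr.
rewrite -mulrA -[sig g _]mul1r; apply: lead_mul => //; first exact: lead_y.
exact: pbw_comm.
Qed.

Lemma invertible_mulI r c : invertible c -> r * c = 0 -> r = 0.
Proof. by move=> [d [_ cd]] rc; rewrite -[r]mulr1 -cd mulrA rc mul0r. Qed.

Lemma sum_lead_nz (I : eqType) (s : seq I) (P : pred I) (v : I -> A)
    (f : I -> 'X_{1..n}) (k : I -> R) : uniq s -> injective f ->
  (forall i, P i -> lead (v i) (f i) (k i) /\ k i <> 0) ->
  (exists2 i, i \in s & P i) -> \sum_(i <- s | P i) v i <> 0.
Proof.
move=> us injf Hv [i is_ Pi]; rewrite -big_filter.
have [|j] := @exp_max _ _ f [seq i <- s | P i].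
  by move=> s0; have := mem_filter P i s; rewrite s0 Pi is_.
rewrite mem_filter => /andP[Pj js] jmax; have [lj kj] := Hv j Pj.
apply: (@lead_nz _ (f j) (k j)) => //.
rewrite (big_rem j) /=; last by rewrite mem_filter Pj.
rewrite -[k j]addr0; apply: leadD => //; apply: lt_lead.
rewrite big_seq_cond; apply: big_ind; [exact: lspan0 | exact: lspanD |].
move=> m /andP[]; rewrite mem_rem_uniq ?filter_uniq // inE => /andP[mj mF] _.
have Pm : P m by move: mF; rewrite mem_filter => /andP[].
apply: lspan_mono (lead_le (Hv m Pm).1) => q /le_lt_trans; apply.
by rewrite lt_neqAle jmax // andbT; apply: contra_neq mj => /injf.
Qed.

End Pbw.

(** * Transfer of ring properties from the coefficients to the extension *)

Section PbwTransfer.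
Variables (R A : pzRingType) (emb : {rmorphism R -> A}) (n : nat).
Variables (y : 'X_{1..n} -> A) (sig : 'X_{1..n} -> R -> R).
Hypothesis H : pbw emb y sig.
Implicit Types (g h : 'X_{1..n}) (r s c : R) (a b : A).
Local Notation lspan := (lspan emb y).
Local Notation lead := (lead emb y).

(* The leading coefficient [l] of [a], at [g], satisfies
   [l * R * sig (g + h) l = 0] for all [h], so [sig (k g) l] lies in the left
   annihilator of [{t * sig (j g) l | j > k}]; these annihilators increase. *)
Lemma pbw_semiprime : elt_semiprime R -> ACC_lann R -> elt_semiprime A.
Proof.
move=> sR aR a aAa; apply: contrapT => /(lead_exists H)[g [l [l0 la]]]; apply: l0.
have ann h t : l * t * sig (g + h)%MM l = 0.
  have [c [cU lgh]] := pbw_mul H g h.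
  have [d [dU lghg]] := pbw_mul H (g + h)%MM g.
  (* With this [r] the factor [emb r * y h] absorbs the unit [c], leaving the arbitrary [t] between
     the two leading coefficients. *)
  have [c' [c'c cc']] := cU; have [r rE] := pbw_surj H g (t * c').
  have := lead_mul H lghg (lead_mul H lgh la (lead_self emb y h r)) la.
  rewrite aAa => l0; apply: (invertible_mulI dU).
  have := lead_uniq H l0 (lt_lead (lspan0 _ _ _)).
  by rewrite rE !mulrA -(mulrA _ c' c) c'c mulr1.
pose X k x := exists t j, (k <= j)%N /\ x = t * sig (g *+ j.+1)%MM l.
have [|N HN] := @aR X.
  by move=> k r Hr _ [t [j [kj ->]]]; apply: Hr; exists t, j; rewrite ltnW.
apply: (sig_eq0 H (g := (g *+ N.+1)%MM)); apply: sR => r.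
rewrite -mulrA; apply: ((HN N.+1 (leqnSn N) _).1); last by exists r, N.
move=> _ [t [j [Nj ->]]].
pose i := (j - N.+1)%N.
have jE : (g *+ j.+1)%MM = (g *+ N.+1 + (g + g *+ i))%MM.
  apply/mnmP => k; rewrite !(mulmnE, mnmDE) -mulnS -mulnDr; congr (_ * _)%N.
  by rewrite addnS subnKC.
have [c [[c' [c'c cc']] lc]] := pbw_mul H (g *+ N.+1)%MM (g + g *+ i)%MM.
have [u uE] := pbw_surj H (g *+ N.+1)%MM (t * c').
rewrite jE; have := sig_comp H l lc => /(congr1 ( *%R c')).
rewrite (mulrA c' c) c'c mul1r => <-.
have := congr1 (sig (g *+ N.+1)%MM) (ann (g *+ i)%MM u).
by rewrite !(sigM H) (sig0 H) uE => E; rewrite !mulrA; rewrite !mulrA in E; rewrite E mul0r.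
Qed.

(** The leading term of [b] is written as [y k * emb m], with its coefficient on the right. If
    [m * r = 0], subtracting it does not change [b * emb r] and lowers the leading exponent, so
    well-founded induction applies. *)
Lemma lead_right_cancel r h b : lspan (le_exp h) b -> b * emb r <> 0 ->
  exists b' k m, [/\ b' * emb r = b * emb r, lead b' k (sig k m) & m * r <> 0].
Proof.
elim/(@ltmwf n): h b => h IHh b bh br0.
have b0 : b <> 0 by move=> b0; apply: br0; rewrite b0 mul0r.
have [k [s [kh _ lb]]] := lspan_lead bh b0; have [m mE] := pbw_surj H k s.
have [mr0|] := pselect (m * r = 0); last by exists b, k, m; rewrite mE.
have lmy : lead (y k * emb m) k s by rewrite -mE; apply: pbw_comm.
have lb' : lspan (lt_exp k) (b - y k * emb m).
  have -> : b - y k * emb m = (b - emb s * y k) - (y k * emb m - emb s * y k).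
      by rewrite opprB addrA subrK.
    exact: lspanB.
have b'r : (b - y k * emb m) * emb r = b * emb r.
  by rewrite mulrBl -mulrA -rmorphM mr0 rmorph0 mulr0 subr0.
have [q [t [qk _ lq]]] : exists q t, [/\ lt_exp k q, t <> 0 & lead (b - y k * emb m) q t].
  by apply: lspan_lead lb' _ => E; apply: br0; rewrite -b'r E mul0r.
rewrite -b'r; apply: (IHh q); [exact: lt_le_trans kh | exact: lead_le lq | by rewrite b'r].
Qed.

(** If [a] is singular, its leading coefficient [l] is singular too: given [r <> 0], some
    [b * emb r <> 0] kills [a]. After [lead_right_cancel] the leading coefficient of the vanishing
    product is [sig k (m * r * l)] up to a unit, with [m * r <> 0]. *)
Lemma pbw_nonsingular : nonsingular R -> nonsingular A.
Proof.
move=> nR a ea; apply: contrapT => /(lead_exists H)[g [l [l0 la]]]; apply: l0.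
apply: nR => r r0.
(* Injectivity of [emb] is not a field of [pbw]; it follows from that of [sig 0]. *)
have er0 : emb r <> 0.
  move=> er0; apply: r0; apply: (sig_eq0 H (g := 0%MM)).
  apply: (lead_uniq H (pbw_comm H 0%MM r)); rewrite er0 mulr0.
  exact: lt_lead (lspan0 _ _ _).
have [b [bra br0]] := ea _ er0.
have b0 : b <> 0 by move=> b0; apply: br0; rewrite b0 mul0r.
have [h [_ [_ /lead_le bh]]] := lead_exists H b0.
have [b' [k [m [b'r lb' mr0]]]] := lead_right_cancel bh br0.
exists m; split=> //.
have [c [cU lc]] := pbw_mul H k g.
have := lead_mul H lc (lead_mulr H r lb') la; rewrite b'r bra => l0.
apply: (sig_eq0 H (g := k)); apply: (invertible_mulI cU).
rewrite !(sigM H).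
exact (lead_uniq H l0 (lt_lead (lspan0 _ _ _))).
Qed.

Lemma lspan_udim (u : nat) (S : seq 'X_{1..n}) : udim_le (@idfun R) (fun=> True) u ->
  uniq S -> udim_le emb (lspan (fun h => h \in S)) (size S * u).
Proof.
move=> dR; elim: S => [_|g S IHS /= /andP[gS uS]].
  rewrite mul0n; apply: (@udim_le_sub _ _ emb _ (fun x => x = 0)); last exact: udim_le0.
  apply: lspan_ind => //.
  by move=> a b -> ->; rewrite addr0.
rewrite mulSn addnC.
apply: (@udim_le_add _ _ _ _ (lspan (fun h => h \in S)) (fun x => exists r, x = emb r * y g)).
- exact: lspan_submod.
- split=> [|_ _ [r ->] [s ->]|t _ [r ->]]; first by exists 0; rewrite rmorph0 mul0r.
    by exists (r + s); rewrite rmorphD mulrDl.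
  by exists (t * r); rewrite rmorphM mulrA.
- by move=> _ /[swap] -[r ->] /(lt_top0 H gS)->; rewrite rmorph0 mul0r.
- move=> x Hx; have [|r Hr] := @lspan_split _ _ _ _ y _ (fun h => h \in S) x g Hx.
    by move=> h; rewrite /= inE => /orP[/eqP->|]; [left|right].
  by exists (emb r * y g) => //; exists r.
- exact: IHS.
move=> I J v Hv Hind.
have /choice[r Hr] : forall i, exists r, i \in J -> v i = emb r * y g.
  move=> i; have [iJ|] := boolP (i \in J); last by exists 0.
  by have [[r ->] _] := Hv i iJ; exists r.
apply: (dR I J r) => [i iJ|c c0 i iJ] /=.
  by split=> // r0; case: (Hv i iJ) => _; rewrite Hr // r0 rmorph0 mul0r.
apply: (@lt_top0 _ _ _ _ _ _ H pred0 g) => //.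
rewrite rmorphM -mulrA -Hr // Hind //; first exact: lspan0.
rewrite (eq_bigr (fun i => emb (c i * r i) * y g)) => [|j jJ].
  by rewrite -mulr_suml -rmorph_sum c0 rmorph0 mul0r.
by rewrite Hr // rmorphM mulrA.
Qed.

Definition tuple_exp (m : nat) (t : n.-tuple 'I_m) : 'X_{1..n} := [multinom (tnth t i : nat) | i < n].

Lemma tuple_exp_inj m : injective (@tuple_exp m).
Proof.
move=> s t /mnmP st; apply: eq_from_tnth => i; apply: val_inj.
by have := st i; rewrite !mnmE.
Qed.

Lemma tuple_exp_mdeg m (t : n.-tuple 'I_m.+1) : (mdeg (tuple_exp t) <= n * m)%N.
Proof.
rewrite mdegE -[n in (n * m)%N]card_ord -sum_nat_const; apply: leq_sum => i _.
by rewrite mnmE -ltnS.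
Qed.

Lemma tuple_exp_surj m g : (mdeg g <= m)%N -> exists t : n.-tuple 'I_m.+1, g = tuple_exp t.
Proof.
move=> gm; exists [tuple inord (g i) | i < n]; apply/mnmP => i.
rewrite mnmE tnth_mktuple inordK // ltnS; apply: leq_trans gm.
by rewrite mdegE (bigD1 i) //= leq_addr.
Qed.

(* Given [N] independent left ideals, the multiples by the [(e + 1) ^ n] monomials
   of a box yield that many independent elements for each ideal, inside the span
   of the at most [((n + 1) * (e + 1)) ^ n] monomials of a bounded degree. *)
Lemma pbw_udim : nonsingular R -> finite_left_udim R -> finite_left_udim A.
Proof.
move=> nR fR [L [lL Lnz Lind]]; have [u dR] := udim_bound fR.
(* As [D.+1 <= n.+1 * e.+1], the dimension bound [D.+1 ^ n * u] is at most [N * e.+1 ^ n], less than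
   the count for [N.+1] ideals. Tying the side of the box to [e] lets [N] be fixed before the
   elements [a k] and their degrees. *)
pose N := (u * n.+1 ^ n)%N.
have /choice[a Ha] : forall k, exists a, L k a /\ a <> 0.
  by move=> k; have [a La /eqP a0] := Lnz k; exists a.
have /choice[gl Hgl] : forall k, exists gl : 'X_{1..n} * R, gl.2 <> 0 /\ lead (a k) gl.1 gl.2.
  by move=> k; have [g [l ?]] := lead_exists H (Ha k).2; exists (g, l).
(* The leading coefficient may be a zero divisor; right multiplication by it is injective on
   [R (s k)], so a multiple of [w i] with zero leading coefficient is itself zero. *)
have /choice[s Hs] : forall k, exists s, s <> 0 /\ forall r, r * s * (gl k).2 = 0 -> r * s = 0.
  move=> k; apply: contrapT => Hno; case: (Hgl k) => l0 _; apply: l0; apply: nR => r r0.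
  apply: contrapT => Ht; apply: Hno; exists r; split=> // t trl; apply: contrapT => tr0.
  by apply: Ht; exists t.
pose e := \max_(k < N.+1) mdeg (gl k).1.
pose D := (n * e + e)%N.
pose S := [seq tuple_exp t | t <- enum {: n.-tuple 'I_D.+1}].
have uS : uniq S by rewrite map_inj_uniq ?enum_uniq //; apply: tuple_exp_inj.
have szS : size S = (D.+1 ^ n)%N by rewrite size_map -cardE card_tuple card_ord.
pose I : finType := ('I_N.+1 * n.-tuple 'I_e.+1)%type.
pose be (i : I) := tuple_exp i.2.
pose w (i : I) := emb (sig (be i) (s i.1)) * (y (be i) * a i.1).
have lw (i : I) c : exists d, invertible d /\
    lead (emb c * w i) (be i + (gl i.1).1)%MM (c * sig (be i) (s i.1 * (gl i.1).2) * d).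
  have [d [dU ld]] := pbw_mul H (be i) (gl i.1).1; exists d; split=> //.
  have := lead_mul H ld (lead_y emb y (be i)) (Hgl i.1).2; rewrite mul1r.
  by move=> /(leadZ (sig (be i) (s i.1)))/(leadZ c); rewrite (sigM H) !mulrA.
have cw0 (i : I) c : c * sig (be i) (s i.1 * (gl i.1).2) = 0 -> c * sig (be i) (s i.1) = 0.
  have [x <-] := pbw_surj H (be i) c; rewrite -!(sigM H) mulrA => /(sig_eq0 H).
  by case: (Hs i.1) => _ /[apply] ->; rewrite (sig0 H).
have := @lspan_udim u S dR uS I [set: I] w; rewrite szS cardsT card_prod card_tuple !card_ord.
suff dS : (D.+1 ^ n * u < N.+1 * e.+1 ^ n)%N.
  move=> Hdim; suff : (N.+1 * e.+1 ^ n <= D.+1 ^ n * u)%N by rewrite leqNgt dS.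
  apply: Hdim => [i _|c c0 i _].
    split.
      have : lspan (le_exp (be i + (gl i.1).1)%MM) (w i).
        apply: lspanZ; apply: lspan_le_mul (H) _ _ _ _ _ _; first exact: lead_le (lead_y _ _ _).
        exact: lead_le (Hgl i.1).2.
      apply: lspan_mono => h /lemc_mdeg; rewrite mdegD => hd.
      have [|t ->] := @tuple_exp_surj D h; last by rewrite /= map_f // mem_enum.
      apply: leq_trans hd _; apply: leq_add; first exact: tuple_exp_mdeg.
      exact: (leq_bigmax i.1).
    have [d [dU]] := lw i 1; rewrite rmorph1 mul1r mul1r => lwi.
    apply: (lead_nz H lwi) => /(invertible_mulI dU)/(sig_eq0 H).
    by case: (Hs i.1) => s0 sl; rewrite -[s i.1]mul1r => /sl; rewrite mul1r.
  pose b k := \sum_(t : n.-tuple 'I_e.+1) emb (c (inord k, t)) * w (inord k, t).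
  have bE (k : 'I_N.+1) : b k = \sum_(t : n.-tuple 'I_e.+1) emb (c (k, t)) * w (k, t).
    by rewrite /b inord_val.
  (* Independence of the ideals separates the blocks. Inside a block the leading exponents are
     distinct, so its nonzero terms cannot cancel. *)
  have b0 : forall k, (k < N.+1)%N -> b k = 0.
    apply: Lind => [k kN|].
      apply: (submod_sum (emb := idfun) _ (lL k)) => t _; have [_ _ LM] := lL k.
      by do 3!apply: (LM); rewrite /= inordK //; case: (Ha k).
    under eq_bigr do rewrite bE.
    rewrite pair_big /= -[RHS]c0; apply: eq_big => [[k t]|[k t] _] //=; by rewrite inE.
  case: i => k t; apply: contrapT => ct0.
  have := b0 k (ltn_ord k); rewrite bE.
  rewrite (bigID (fun t => emb (c (k, t)) * w (k, t) != 0)) /= [X in _ + X]big1 => [|t' /negPn/eqP//].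
  rewrite addr0; have /choice[d Hd] := fun t => lw (k, t) (c (k, t)).
  apply: (sum_lead_nz H (f := fun t => (be (k, t) + (gl k).1)%MM)
     (k := fun t => c (k, t) * sig (be (k, t)) (s k * (gl k).2) * d t)).
  - exact: index_enum_uniq.
  - move=> t1 t2 /mnmP E; apply: tuple_exp_inj; apply/mnmP => j.
    by have := E j; rewrite !mnmDE => /addIn.
  - move=> t' /eqP w0; have [dU lt'] := Hd t'; split=> // /(invertible_mulI dU)/cw0 cs0.
    by apply: w0; rewrite /w mulrA -rmorphM cs0 rmorph0 mul0r.
  - by exists t; [exact: mem_index_enum | apply/eqP].
have DE : (D.+1 <= n.+1 * e.+1)%N by rewrite /D mulSn mulnS addSn ltnS addnC leq_add2l leq_addl.
apply: leq_ltn_trans (_ : N * e.+1 ^ n < _)%N; last first.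
  by rewrite ltn_mul2r ltnSn expn_gt0.
have powM j k m : (j <= k)%N -> (j ^ m <= k ^ m)%N.
  by case: m => // m jk; rewrite leq_exp2r.
by rewrite /N mulnC -mulnA -expnMn leq_mul2l powM ?orbT.
Qed.

End PbwTransfer.

Lemma pbw_goldie (R A : pzRingType) (emb : {rmorphism R -> A}) (n : nat)
    (y : 'X_{1..n} -> A) (sig : 'X_{1..n} -> R -> R) :
  pbw emb y sig -> elt_semiprime R -> left_goldie R -> elt_semiprime A /\ left_goldie A.
Proof.
move=> H sR [aR fR]; have nR := semiprime_nonsingular sR aR.
split; first exact: pbw_semiprime H sR aR.
have fA := pbw_udim H nR fR.
by split=> //; apply: nonsingular_ACC_lann fA; apply: pbw_nonsingular H nR.
Qed.

(** * Passage to opposite rings *)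

Section Converse.
Variables (R A : pzRingType) (emb : {rmorphism R -> A}).

Definition emb_conv (r : R^c) : A^c := emb r.

Fact emb_conv_zmod : zmod_morphism emb_conv.
Proof. by move=> r s; apply: (rmorphB emb). Qed.

Fact emb_conv_monoid : monoid_morphism emb_conv.
Proof. by split=> [|r s]; [apply: (rmorph1 emb) | apply: (rmorphM emb s r)]. Qed.

HB.instance Definition _ := GRing.isZmodMorphism.Build R^c A^c emb_conv emb_conv_zmod.
HB.instance Definition _ := GRing.isMonoidMorphism.Build R^c A^c emb_conv emb_conv_monoid.

Variables (n : nat) (y : 'X_{1..n} -> A) (sig : 'X_{1..n} -> R -> R).
Hypothesis H : pbw emb y sig.

Let yc : 'X_{1..n} -> A^c := y.
Local Notation lspanc := (lspan emb_conv yc).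

Lemma lspanc_term (P : pred 'X_{1..n}) g r : P g -> lspanc P (y g * emb r).
Proof. exact: lspan1. Qed.

(** Moving a coefficient to the right of its monomial costs only smaller exponents, which remain in
    the down-closed [P]; well-founded induction absorbs them. *)
Lemma lspan_to_conv (P : pred 'X_{1..n}) a :
  (forall g h, P g -> (h <= g)%O -> P h) -> lspan emb y P a -> lspanc P a.
Proof.
move=> Pdown; elim/lspan_ind => [|b1 b2|g r]; [exact: lspan0 | exact: lspanD |].
elim/(@ltmwf n): g r => g IHg r Pg; have [s <-] := pbw_surj H g r.
have -> : emb (sig g s) * y g = y g * emb s - (y g * emb s - emb (sig g s) * y g).
  by rewrite subKr.
apply: (lspanB (P := P)); first exact: lspanc_term.
elim/lspan_ind: (pbw_comm H g s) => [|b1 b2|h t hg]; [exact: lspan0 | exact: lspanD |].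
by apply: IHg => //; apply: Pdown Pg _; apply: ltW.
Qed.

Lemma lt_exp_down (g h k : 'X_{1..n}) : lt_exp g h -> (k <= h)%O -> lt_exp g k.
Proof. by move=> hg kh; apply: le_lt_trans hg. Qed.

Lemma lead_conv a g r : lspan emb y (lt_exp g) (a - y g * emb r) -> lead emb_conv yc a g r.
Proof. by move=> la; apply: lspan_to_conv la => h k; apply: lt_exp_down. Qed.

Lemma sig_invertible g c : invertible (sig g c) -> invertible c.
Proof.
move=> [d [dc cd]]; have [e eE] := pbw_surj H g d; exists e.
by split; apply: (pbw_inj H (g := g)); rewrite (sigM H) eE (sig1 H).
Qed.

(** The twists of the opposite structure are the inverses of the [sig g]. Reversed products are
    compared through commutativity of exponent addition, and the unit is pulled back along
    [sig (g + h)]. *)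
Lemma pbw_conv : exists sigc, pbw emb_conv yc sigc.
Proof.
have /choice[sigc sigcE] : forall g, exists f : R -> R, forall s, sig g (f s) = s.
  by move=> g; have /choice[f Hf] := pbw_surj H g; exists f.
exists sigc; split.
- move=> s c us sum0 g gs; apply: contrapT => cg0.
  have ld h : lead emb y (y h * emb (c h)) h (sig h (c h)) by apply: pbw_comm.
  apply: (sum_lead_nz H (s := s) (P := fun h => c h != 0) (f := id)
    (v := fun h => y h * emb (c h)) (k := fun h => sig h (c h))) => //.
  + by move=> h /eqP ch0; split=> // /(sig_eq0 H).
  + by exists g => //; apply/eqP.
  rewrite -[RHS]sum0 [RHS](bigID (fun h => c h != 0)) /= [X in _ + X]big1 ?addr0 // => h.
  by move=> /negPn/eqP->; rewrite rmorph0 mul0r.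
- by move=> a; apply: lspan_to_conv (pbw_span H a).
- move=> g r; apply: lead_conv; rewrite -opprB; apply: lspanN.
  by have := pbw_comm H g (sigc g r); rewrite sigcE.
- by move=> g r s rs; rewrite -(sigcE g r) -(sigcE g s) rs.
- by move=> g s; exists (sig g s); apply: (pbw_inj H (g := g)); rewrite sigcE.
move=> g h; have [c [cU lc]] := pbw_mul H h g.
rewrite addmC in lc; have [d dE] := pbw_surj H (g + h)%MM c.
exists d; split.
  by have [e [ed de]] : invertible d; [apply: (@sig_invertible (g + h)%MM); rewrite dE | exists e].
apply: lead_conv.
have -> : y h * y g - y (g + h)%MM * emb d = (y h * y g - emb c * y (g + h)%MM)
  - (y (g + h)%MM * emb d - emb c * y (g + h)%MM) by rewrite opprB addrA subrK.
by apply: lspanB => //; rewrite -dE; apply: pbw_comm.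
Qed.

End Converse.

(** * Skew PBW extensions *)

Section SkewPbw.
Variables (R A : pzRingType) (emb : {rmorphism R -> A}) (n : nat) (x : 'I_n -> A).
Hypotheses (HA : skew_PBW emb x) (HB : bijective_skew_PBW emb x).
Implicit Types (g h : 'X_{1..n}) (i j : 'I_n) (r s c : R) (a b : A).

Definition mon (g : 'X_{1..n}) : A := monom x g.
Local Notation lspan := (lspan emb mon).
(** The error terms of the defining relations drop in total degree, so straightening is controlled
    by degree alone; [deg_lt_lt_exp] refines this to the monomial order. *)
Definition deg_lt (d : nat) : pred 'X_{1..n} := fun g => (mdeg g < d)%N.

Lemma monE g : mon g = \prod_(i < n) x i ^+ g i. Proof. by []. Qed.

Lemma mon0 : mon 0%MM = 1.
Proof. by rewrite monE big1 // => i _; rewrite mnm0E. Qed.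

Lemma mon_cons j g : (forall i, (i < j)%N -> g i = 0%N) ->
  x j * mon g = mon (U_(j) + g)%MM.
Proof.
have enumE (F : 'I_n -> A) : \prod_(i < n) F i = \prod_(i <- enum 'I_n) F i.
  by rewrite enumT [index_enum _]unlock.
move=> gj; rewrite !monE !enumE.
have : sorted ltn (map val (enum 'I_n)) by rewrite val_enum_ord iota_ltn_sorted.
have : j \in enum 'I_n by rewrite mem_enum.
elim: (enum 'I_n) => [//|i s IHs]; rewrite inE => /orP[/eqP<-|js] /= ss.
  rewrite !big_cons mulrA -exprS mnmDE mnm1E eqxx; congr (_ * _).
  apply: eq_big_seq => k ks; rewrite mnmDE mnm1E; case: eqP => // jk.
  have := order_path_min ltn_trans ss; rewrite all_map => /allP/(_ _ ks) /=.
  by rewrite jk ltnn.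
have ij : (i < j)%N.
  by have := order_path_min ltn_trans ss; rewrite all_map => /allP/(_ _ js).
rewrite !big_cons mnmDE mnm1E gj // -val_eqE gtn_eqF // !mul1r.
by apply: IHs => //; apply: path_sorted ss.
Qed.

Lemma mon1 j : mon U_(j)%MM = x j.
Proof. by rewrite -[U_(j)%MM]addm0 -mon_cons ?mon0 ?mulr1 // => i _; rewrite mnm0E. Qed.

Lemma mon_decomp g : g <> 0%MM ->
  exists j h, g = (U_(j) + h)%MM /\ forall i, (i < j)%N -> g i = 0%N.
Proof.
move=> g0; have [i0 gi0] : exists i, g i != 0%N.
  apply: contrapT => Hno; apply: g0; apply/mnmP => i; rewrite mnm0E.
  by apply/eqP; apply: contrapT => gi; apply: Hno; exists i; apply/negP.
pose j := [arg min_(i < i0 | g i != 0%N) i]; exists j.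
rewrite /j; case: arg_minnP => // {}j gj jmin; exists (g - U_(j))%MM; split.
  apply/mnmP => i; rewrite mnmDE mnmBE mnm1E; case: eqP => [<-|_].
    by rewrite subnKC // lt0n.
  by rewrite subn0.
by move=> i ij; apply/eqP; apply: contraTT ij => /jmin; rewrite -leqNgt.
Qed.

Lemma mon_free (s : seq 'X_{1..n}) (c : 'X_{1..n} -> R) : uniq s ->
  \sum_(g <- s) emb (c g) * mon g = 0 -> forall g, g \in s -> c g = 0.
Proof.
move=> us s0 g gs; have [_ _ free _ _] := HA.
have := free [seq val h | h <- s] (fun t => c (Multinom t)) _ _ (val g) (map_f _ gs).
case: g gs => t gs /=; apply; first by rewrite map_inj_uniq //; apply: val_inj.
by rewrite big_map -[RHS]s0; apply: eq_bigr => -[].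
Qed.

Lemma mon_span a : lspan predT a.
Proof.
have [_ span _ _ _] := HA; have [s [c ->]] := span a.
apply: (submod_sum _ (lspan_submod _ _ _)) => t _.
exact: (@lspan1 _ _ _ _ mon predT (Multinom t)).
Qed.

Lemma linear_uniq i r s r' s' : emb r * x i + emb s = emb r' * x i + emb s' -> r = r'.
Proof.
move=> E; have U0 : (U_(i) == 0 :> 'X_{1..n})%MM = false by rewrite -mdeg_eq0 mdeg1.
have := @mon_free [:: U_(i)%MM; 0%MM] (fun g => if g == 0%MM then s - s' else r - r').
move=> /= /(_ _ _ U_(i)%MM (mem_head _ _)); rewrite U0 => F.
apply/eqP; rewrite -subr_eq0; apply/eqP; apply: F; first by rewrite inE U0.
rewrite !big_cons big_nil U0 eqxx mon0 mon1 mulr1 addr0 !rmorphB mulrBl.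
by rewrite addrACA -opprD E subrr.
Qed.

Lemma sigma_exists : exists sd : 'I_n -> R -> R * R, forall i r,
  x i * emb r = emb (sd i r).1 * x i + emb (sd i r).2.
Proof.
have /choice[f Hf] : forall ir : 'I_n * R, exists p : R * R,
    x ir.1 * emb ir.2 = emb p.1 * x ir.1 + emb p.2.
  move=> [i r]; have [_ _ _ comm _] := HA.
  have [->|/(comm i)[c [_ [d E]]]] := eqVneq r 0.
    by exists (0, 0); rewrite /= rmorph0 mulr0 mul0r addr0.
  by exists (c, d); rewrite /= -E addrC subrK.
by exists (fun i r => f (i, r)) => i r; apply: (Hf (i, r)).
Qed.

Section Sigma.
Variable sd : 'I_n -> R -> R * R.
Hypothesis sdE : forall i r, x i * emb r = emb (sd i r).1 * x i + emb (sd i r).2.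
Let sg i r := (sd i r).1.

Lemma sgP i r s d : x i * emb r = emb s * x i + emb d -> sg i r = s.
Proof. by rewrite sdE => /linear_uniq. Qed.

Lemma sgM i r s : sg i (r * s) = sg i r * sg i s.
Proof.
apply: (@sgP _ _ _ (sg i r * (sd i s).2 + (sd i r).2 * s)).
by rewrite rmorphM mulrA sdE mulrDl -mulrA sdE mulrDr !mulrA -!rmorphM -addrA -rmorphD.
Qed.

Lemma sg1 i : sg i 1 = 1.
Proof. by apply: (@sgP _ _ _ 0); rewrite !rmorph1 rmorph0 mul1r mulr1 addr0. Qed.

Lemma sg_invertible i c : invertible c -> invertible (sg i c).
Proof.
by move=> [d [dc cd]]; exists (sg i d); rewrite -!sgM dc cd sg1.
Qed.

Lemma invertibleM c d : invertible c -> invertible d -> invertible (c * d).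
Proof.
move=> [c' [c'c cc']] [d' [d'd dd']]; exists (d' * c'); split.
  by rewrite mulrA -(mulrA d') c'c mulr1.
by rewrite mulrA -(mulrA c) dd' mulr1.
Qed.

Lemma invertible1 : invertible (1 : R).
Proof. by exists 1; rewrite mulr1. Qed.

Lemma sg_inj i : injective (sg i).
Proof.
have [bij _] := HB; have [_ inj] := bij i; move=> r s rs.
by apply: (inj r s (sg i r)); [exists (sd i r).2 | rewrite rs; exists (sd i s).2].
Qed.

Lemma sg_surj i s : exists r, sg i r = s.
Proof.
have [bij _] := HB; have [surj _] := bij i.
by have [r [d rE]] := surj s; exists r; apply: sgP rE.
Qed.

(* The bound [d] in the first hypothesis makes this available inside the
   induction on degrees that proves [x_mon]. *)
Lemma x_leading j d a c h :
  (forall g, (mdeg g < d)%N -> lspan (deg_lt (mdeg g).+2) (x j * mon g)) ->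
  (mdeg h <= d)%N -> lspan (deg_lt d) (a - emb c * mon h) ->
  lspan (deg_lt d.+1) (x j * a - emb (sg j c) * (x j * mon h)).
Proof.
move=> Hj hd la.
have lower b : lspan (deg_lt d) b -> lspan (deg_lt d.+1) (x j * b).
  elim/lspan_ind => [|b1 b2|g r gd].
  - by rewrite mulr0; apply: lspan0.
  - by rewrite mulrDr; apply: lspanD.
  rewrite mulrA sdE mulrDl; apply: lspanD; last by apply: lspan1; apply: ltnW.
  rewrite -mulrA; apply: lspanZ; apply: lspan_mono (Hj g gd) => k; rewrite /deg_lt => kg.
  exact: leq_trans kg _.
have -> : x j * a - emb (sg j c) * (x j * mon h)
    = x j * (a - emb c * mon h) + emb (sd j c).2 * mon h.
  rewrite mulrBr [x j * (_ * _)]mulrA sdE mulrDl opprD addrA addrNK.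
  by rewrite mulrA.
by apply: lspanD; [apply: lower | apply: lspan1; rewrite /deg_lt ltnS].
Qed.

Lemma x_mon_lt g i c :
  lspan (deg_lt (mdeg g).+1) (x i * mon g - emb c * mon (U_(i) + g)%MM) ->
  lspan (deg_lt (mdeg g).+2) (x i * mon g).
Proof.
move=> Hc; rewrite -[x i * mon g](subrK (emb c * mon (U_(i) + g)%MM)); apply: lspanD.
  by apply: lspan_mono Hc => k /leqW.
by apply: lspan1; rewrite /deg_lt mdegD mdeg1.
Qed.

(** Let [x j] be the first variable of [mon g], so [g = U_(j) + h]. If [i <= j], the product is
    already ordered. Otherwise [x i] is swapped with [x j] at the cost of a unit, and [x i * mon h]
    is straightened by induction on the degree. Putting [x j] back in front is free, because [j]
    precedes [i] and every variable of [h]. *)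
Lemma x_mon g i : exists c, invertible c /\
  lspan (deg_lt (mdeg g).+1) (x i * mon g - emb c * mon (U_(i) + g)%MM).
Proof.
have [d] := ubnP (mdeg g); elim: d g i => // d IHd g i; rewrite ltnS => gd.
have cons : (forall k : 'I_n, (k < i)%N -> g k = 0%N) -> exists c, invertible c /\
    lspan (deg_lt (mdeg g).+1) (x i * mon g - emb c * mon (U_(i) + g)%MM).
  move=> gi; exists 1; split; first exact: invertible1.
  by rewrite rmorph1 mul1r mon_cons // subrr; apply: lspan0.
have [g0|/eqP/mon_decomp[j [h [gE gj]]]] := eqVneq g 0%MM.
  by apply: cons => k _; rewrite g0 mnm0E.
have [ij|ji] := leqP i j; first by apply: cons => k ki; apply: gj; apply: leq_trans ki ij.
have gh : mdeg g = (mdeg h).+1 by rewrite gE mdegD mdeg1.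
have hj (k : 'I_n) : (k < j)%N -> h k = 0%N.
  by move=> /gj; rewrite gE mnmDE => /eqP; rewrite addn_eq0 => /andP[_ /eqP].
have xlt k f : (mdeg f < mdeg g)%N -> lspan (deg_lt (mdeg f).+2) (x k * mon f).
  move=> fg; have [c [_ Hc]] := IHd f k (leq_trans fg gd).
  exact: x_mon_lt Hc.
have [_ _ _ _ rel] := HA; have [_ bij] := HB.
have [c [_ Ec]] := rel j i; have cU := bij j i ji c Ec; have [d0 [e E]] := Ec.
have hd : (mdeg h < d)%N by rewrite -gh.
have [c' [c'U Hc']] := IHd h i hd.
have Hj := @x_leading j (mdeg g) (x i * mon h) c' (U_(i) + h)%MM (xlt j).
rewrite mdegD mdeg1 add1n -gh in Hj; have {}Hj := Hj (leqnn _); rewrite gh in Hj.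
have {}Hj := Hj Hc'.
exists (c * sg j c'); split; first by apply: invertibleM => //; apply: sg_invertible.
have xjE : x j * mon (U_(i) + h)%MM = mon (U_(i) + g)%MM.
  rewrite mon_cons ?gE ?addmA ?[(U_(j) + _)%MM]addmC // => k kj.
  by rewrite mnmDE mnm1E hj // -val_eqE gtn_eqF // (ltn_trans kj).
rewrite xjE in Hj.
have -> : x i * mon g - emb (c * sg j c') * mon (U_(i) + g)%MM
  = (emb d0 * mon h + \sum_(k < n) emb (e k) * (x k * mon h))
    + emb c * (x j * (x i * mon h) - emb (sg j c') * mon (U_(i) + g)%MM).
  rewrite mulrBr rmorphM !mulrA addrA; congr (_ - _).
  rewrite gE -mon_cons // mulrA -[x i * x j](subrK (emb c * (x j * x i))) E.
  rewrite !mulrDl mulr_suml !mulrA; congr (_ + _ + _).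
  by apply: eq_bigr => k _; rewrite mulrA.
rewrite gh; apply: lspanD; last exact: lspanZ.
apply: lspanD; first by apply: lspan1; rewrite /deg_lt ltnW.
apply: (submod_sum _ (lspan_submod _ _ _)) => k _; apply: lspanZ.
by apply: xlt; rewrite gh.
Qed.

Lemma x_lead j d a c h : (mdeg h <= d)%N -> lspan (deg_lt d) (a - emb c * mon h) ->
  lspan (deg_lt d.+1) (x j * a - emb (sg j c) * (x j * mon h)).
Proof.
by apply: x_leading => g _; have [e [_ He]] := x_mon g j; apply: x_mon_lt He.
Qed.

Lemma mon_ind (K : 'X_{1..n} -> Prop) : K 0%MM ->
  (forall j h, K h -> mon (U_(j) + h)%MM = x j * mon h -> K (U_(j) + h)%MM) ->
  forall g, K g.
Proof.
move=> K0 KS g; have [d] := ubnP (mdeg g); elim: d g => // d IHd g; rewrite ltnS => gd.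
have [->//|/eqP/mon_decomp[j [h [gE gj]]]] := eqVneq g 0%MM.
rewrite gE; apply: KS.
  by apply: IHd; apply: leq_trans gd; rewrite gE mdegD mdeg1.
rewrite mon_cons // => k /gj; rewrite gE mnmDE => /eqP.
by rewrite addn_eq0 => /andP[_ /eqP].
Qed.

Lemma mon_comm g : exists f : R -> R, [/\ injective f, forall s, exists r, f r = s
  & forall r, lspan (deg_lt (mdeg g)) (mon g * emb r - emb (f r) * mon g)].
Proof.
elim/mon_ind: g => [|j h [f [finj fsurj fE]] monS].
  exists id; split=> [r s //|s|r]; first by exists s.
  by rewrite mon0 mul1r mulr1 subrr; apply: lspan0.
exists (sg j \o f); split=> [r s /sg_inj/finj//|s|r].
  by have [t <-] := sg_surj j s; have [r <-] := fsurj t; exists r.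
have := x_lead j (leqnn _) (fE r).
by rewrite monS mdegD mdeg1 !mulrA.
Qed.

Lemma mon_mul g h : exists c, invertible c /\
  lspan (deg_lt (mdeg (g + h)%MM)) (mon g * mon h - emb c * mon (g + h)%MM).
Proof.
elim/mon_ind: g => [|j g [c [cU Hc]] monS].
  exists 1; split; first exact: invertible1.
  by rewrite add0m mon0 rmorph1 !mul1r subrr; apply: lspan0.
have [d [dU Hd]] := x_mon (g + h)%MM j.
exists (sg j c * d); split; first by apply: invertibleM => //; apply: sg_invertible.
have := lspanD (x_lead j (leqnn _) Hc) (lspanZ (sg j c) Hd).
rewrite monS -addmA [mdeg (U_(j) + _)%MM]mdegD mdeg1 add1n.
by rewrite mulrBr addrA subrK rmorphM !mulrA.
Qed.

End Sigma.

Lemma deg_lt_lt_exp g a : lspan (deg_lt (mdeg g)) a -> lspan (lt_exp g) a.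
Proof. by apply: lspan_mono => h; apply: lt_mdeg_ltmc. Qed.

Lemma skew_pbw : exists sig, pbw emb mon sig.
Proof.
have [sd sdE] := sigma_exists.
have /choice[sig Hsig] := mon_comm sdE.
exists sig; split; [exact: mon_free | exact: mon_span | | | |].
- by move=> g r; case: (Hsig g) => _ _ /(_ r)/deg_lt_lt_exp.
- by move=> g; case: (Hsig g).
- by move=> g; case: (Hsig g).
by move=> g h; have [c [cU /deg_lt_lt_exp]] := mon_mul sdE g h; exists c.
Qed.

End SkewPbw.

Theorem theorem4p8 (R A : pzRingType) (emb : {rmorphism R -> A}) (n : nat)
    (x : 'I_n -> A) :
  skew_PBW emb x -> bijective_skew_PBW emb x ->
  ((semiprime R /\ left_goldie R) ->
     (semiprime A /\ left_goldie A) /\ Ql_exists_semisimple A) /\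
  ((semiprime R /\ right_goldie R) ->
     (semiprime A /\ right_goldie A) /\ Qr_exists_semisimple A).
Proof.
move=> HA HB; have [sig H] := skew_pbw HA HB; split=> -[/semiprime_elt sR gR].
  have [sA gA] := pbw_goldie H sR gR.
  by split; [split=> //; apply: elt_semiprimeP | apply: left_goldie_theorem].
have [sigc Hc] := pbw_conv H.
(* [right_goldie] is convertible to [left_goldie] of the opposite ring, so [gR] applies and [gA] is
   returned unchanged. *)
have [sA gA] := pbw_goldie Hc (elt_semiprime_conv sR) gR.
have {}sA : elt_semiprime A := elt_semiprime_conv sA.
by split; [split=> //; apply: elt_semiprimeP | apply: right_goldie_theorem].
Qed.
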